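(* Let $I\subset\mathbb{R}$ be a bounded interval. Then there exists a constant $c=c(I)$ such that for every $f\in BV(I)$, $Mf\in W^{1,1}(I)$ and $\|Mf\|_{W^{1,1}(I)}\le c\,\|f\|_{BV(I)}$.
   Context: An interval means a nondegenerate interval of $\mathbb{R}$. $\lambda$ is Lebesgue measure. $Df$ denotes the distributional derivative of $f$ and $|Df|$ its total variation. $BV(I)=\{f:I\to\mathbb{R}\mid f\in L^1(I),\ |Df|(I)<\infty\}$ with norm $\|f\|_{BV(I)}=\|f\|_{L^1(I)}+|Df|(I)$. $W^{1,1}(I)=\{f:I\to\mathbb{R}\mid f\in L^1(I),\ Df\text{ is a function, and }Df\in L^1(I)\}$ with norm $\|f\|_{W^{1,1}(I)}=\|f\|_{L^1(I)}+\|Df\|_{L^1(I)}$. For locally integrable $f:I\to\mathbb{R}$, the noncentered Hardy-Littlewood maximal function is $Mf(x)=\sup_{x\in J\subset I}\frac{1}{\lambda(J)}\int_J|f(y)|\,dy$, the supremum being over intervals $J\subset I$ of finite length containing $x$. *)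

(* Defs.v *)
From HB Require Import structures.
From mathcomp Require Import all_boot all_order all_algebra.
From mathcomp Require Import all_classical all_reals all_analysis.

Set Implicit Arguments.
Unset Strict Implicit.
Unset Printing Implicit Defensive.

Import Order.TTheory GRing.Theory Num.Theory.
Import numFieldNormedType.Exports.

Local Open Scope classical_set_scope.
Local Open Scope ring_scope.

(* A function I -> R is represented by a function R -> R, of which only the
   values on I matter. *)

Definition nondegenerate_interval (R : realType) (J : set R) : Prop :=
  is_interval J /\ exists a b, [/\ J a, J b & a < b].

Definition L1 (R : realType) (I : set R) (f : R -> R) : Prop :=
  (@lebesgue_measure R).-integrable I (EFin \o f).

Definition L1norm (R : realType) (I : set R) (f : R -> R) : \bar R :=
  (\int[@lebesgue_measure R]_(x in I) `|(f x)%:E|)%E.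

(* The space C_c^oo(U) for U open; its elements are extended by 0 to R. *)
Definition test_function (R : realType) (U : set R) (phi : R -> R) : Prop :=
  (forall n x, derivable (derive1n n phi) x 1) /\
  exists K : set R, [/\ compact K, K `<=` U & forall x, ~ K x -> phi x = 0].

(* Df as a distribution on the interior of I: <Df, phi> = - \int f phi'. *)
Definition distr_derive (R : realType) (I : set R) (f phi : R -> R) : R :=
  - (\int[@lebesgue_measure R]_(x in I°) (f x * derive1 phi x)).

(* |Df|(I), with value +oo when Df is not a finite Radon measure. The
   supremum is over test functions on the interior of I, so that a closed
   endpoint of I carries no mass. *)
Definition derive_variation (R : realType) (I : set R) (f : R -> R) : \bar R :=
  ereal_sup [set (distr_derive I f phi)%:E |
    phi in [set phi | test_function I° phi /\ forall x, `|phi x| <= 1]].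

Definition BV (R : realType) (I : set R) (f : R -> R) : Prop :=
  L1 I f /\ (derive_variation I f < +oo)%E.

Definition BVnorm (R : realType) (I : set R) (f : R -> R) : \bar R :=
  (L1norm I f + derive_variation I f)%E.

(* "Df is the function g". *)
Definition is_weak_derive (R : realType) (I : set R) (f g : R -> R) : Prop :=
  locally_integrable I° g /\
  forall phi, test_function I° phi ->
    distr_derive I f phi = \int[@lebesgue_measure R]_(x in I°) (g x * phi x).

Definition W11 (R : realType) (I : set R) (f : R -> R) : Prop :=
  L1 I f /\ exists2 g, is_weak_derive I f g & L1 I g.

(* All weak derivatives of f agree almost everywhere on I, so the infimum is
   over at most one value: ||Df||_{L^1(I)} if Df is a function (and the
   infimum is +oo if it is not). *)
Definition W11norm (R : realType) (I : set R) (f : R -> R) : \bar R :=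
  (L1norm I f + ereal_inf [set L1norm I g | g in is_weak_derive I f])%E.

Definition maximal_function (R : realType) (I : set R) (f : R -> R) (x : R) :
    \bar R :=
  ereal_sup [set iavg f J |
    J in [set J : set R | [/\ nondegenerate_interval J, bounded_set J,
                              J x & J `<=` I]]].

(* Main.v *)
(* Put A(z) = \int_a^z |f|, where a < b are the ends of I. Every average over
   an interval around x lies below one of its two one-sided parts, so Mf(x) is
   the largest slope u(x) of a chord of A from x.

   Testing Df against smooth approximations of sums of signed indicators
   bounds by |Df|(I) the variation of f along lists of Lebesgue points; let V
   be the resulting variation function of g = |f|. As any
   number below the slope of a chord is exceeded by g at some Lebesgue point
   under that chord, u is continuous and of variation at most V(b) + O(sup g).

   The main point is that u maps null sets to null sets. The points where u(x)
   is not approached by chords of length < h form a set where u is Lipschitz.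
   At the other points u is local: if g is monotone up to an error E near
   a cell of length h, the values of u there lie within O(E) of each other.
   On the gaps of a list of Lebesgue points that nearly exhausts the variation,
   g is monotone up to errors of small total size.

   Since |u(y) - u(x)| is at most the measure of u(]x, y]), null sets do not
   contribute to the variation measure of u, which therefore has a density; so
   does u, and this density is its weak derivative. *)
Require Import Defs.
From HB Require Import structures.
From mathcomp Require Import all_boot all_order all_algebra.
From mathcomp Require Import all_classical all_reals all_analysis.
From mathcomp Require Import measurable_realfun ring lra.
Import Order.TTheory GRing.Theory Num.Theory.
Import numFieldNormedType.Exports.
Local Open Scope classical_set_scope.
Local Open Scope ring_scope.

(** The obstacle is the singular part of the derivative of g: jumps and Cantor parts may put most of
    the variation of g on a null set, so bounding the image of that set by the variation of g nearby
    gives nothing small. What makes the noncentered maximal function smoother than g is that a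
    monotone stretch of g costs nothing. Where g increases, a chord from x to the right sees values
    at least as large as those near x, so the points of a short cell at which u is approached by
    short chords all have nearly the same u. Only the oscillation of g in excess of a monotone
    function counts, and along a list of points that nearly exhausts the variation of g the total
    excess is small. The values of f on null sets are arbitrary, and no good representative of f is
    built: g is sampled at Lebesgue points only, and A carries the rest of the information. The
    image of a null set under u is not known to be measurable beforehand, so images are estimated by
    outer measure. *)

(** * Outer Lebesgue measure of images *)

Section Images.
Context {R : realType}.
Local Open Scope ereal_scope.

(* Lebesgue measure on all subsets of [R], where it is an outer measure. *)
Definition lam : {outer_measure set (ocitv_type R) -> \bar R} :=
  (wlength (idfun : cumulative R R))^*%mu.

Lemma lamE (A : set R) : lam A = lebesgue_measure A.
Proof. by []. Qed.

Lemma lam_itv (m M : R) : (m <= M)%R -> lam `[m, M]%classic = (M - m)%:E.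
Proof.
move=> mM; rewrite lamE lebesgue_measure_itv /= lte_fin.
by case: ltgtP mM => // -> _; rewrite subrr.
Qed.

Lemma lam_diam (T : set R) (r : R) : (0 <= r)%R ->
  (forall x y, T x -> T y -> (x - y <= r)%R) -> lam T <= r%:E.
Proof.
move=> r0 hT; have [->|/set0P[t0 Tt0]] := eqVneq T set0.
  by rewrite outer_measure0 lee_fin.
have lbT : has_lbound T by exists (t0 - r)%R => y Ty; have := hT t0 y Tt0 Ty; lra.
have ubT : has_ubound T by exists (t0 + r)%R => y Ty; have := hT y t0 Ty Tt0; lra.
have i0 : (inf T <= t0)%R by exact: ge_inf.
have s0 : (t0 <= sup T)%R by exact: ub_le_sup.
have sub : T `<=` `[inf T, sup T]%classic.
  by move=> x Tx /=; rewrite in_itv /= ge_inf//= ub_le_sup.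
apply: le_trans (le_outer_measure lam _ _ sub) _.
rewrite lam_itv ?(le_trans i0)// lee_fin lerBlDr.
apply: ge_sup; first by exists t0.
move=> x Tx; rewrite -lerBlDl; apply: lb_le_inf; first by exists t0.
by move=> y Ty; have := hT x y Tx Ty; lra.
Qed.

(** A half-open interval []p, q]] of a cover of [A] meets [A] in a set whose image has diameter at
    most [L * (w q - w p)]; summing over the cover compares the two outer measures, so [A] may be
    any set. The identity for [w] gives the Lipschitz case, a variation function the bound by the
    variation measure. *)
Lemma lam_image_le (w : cumulative R R) (u : R -> R) (L : R) (A : set R) :
  (0 < L)%R ->
  (forall x y, A x -> A y -> (x <= y)%R -> (`|u y - u x| <= L * (w y - w x))%R) ->
  lam (u @` A) <= L%:E * lebesgue_stieltjes_measure w A.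
Proof.
move=> L0 hu; rewrite -lee_pdivrMl//.
apply: le_ereal_inf_tmp => _ [F [mF AF] <-].
rewrite lee_pdivrMl// -nneseriesZl//.
have sub : u @` A `<=` \bigcup_k (u @` (A `&` F k)).
  by move=> _ [x Ax <-]; have [k _ Fkx] := AF x Ax; exists k => //; exists x.
apply: le_trans (le_outer_measure lam _ _ sub) _.
apply: le_trans (outer_measure_sigma_subadditive lam _) _.
apply: lee_nneseries => [k _ _|k _]; first exact: outer_measure_ge0.
have /ocitvP[->|[[p q] /= pq Fk]] := mF k.
  rewrite setI0 image_set0 outer_measure0.
  by apply: mule_ge0; [rewrite lee_fin ltW|exact: wlength_ge0].
have wnd (x y : R) : (x <= y)%R -> (w x <= w y)%R.
  by move=> xy; apply: cumulative_is_nondecreasing.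
rewrite Fk wlength_itv_bnd ?(ltW pq)// -EFinM; apply: lam_diam.
  by rewrite mulr_ge0 ?subr_ge0 ?wnd// ltW.
move=> _ _ [x [Ax /=]] + <- [y [Ay /=]] + <-.
rewrite !in_itv /= => /andP[px xq] /andP[py yq].
suff main (s t : R) : A s -> A t -> (s <= t)%R -> (p < s)%R -> (t <= q)%R ->
    (`|u t - u s| <= L * (w q - w p))%R.
  have [xy|yx] := leP x y.
    by apply: le_trans (main x y Ax Ay xy px yq); rewrite distrC ler_norm.
  by apply: le_trans (main y x Ay Ax (ltW yx) py xq); rewrite ler_norm.
move=> As At st ps tq; apply: le_trans (hu s t As At st) _.
by rewrite ler_wpM2l ?(ltW L0)// lerB ?wnd// ltW.
Qed.

Lemma lam_image_null (u : R -> R) (L : R) (A : set R) :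
  (forall x y, A x -> A y -> (x <= y)%R -> (`|u y - u x| <= L * (y - x))%R) ->
  lam A = 0 -> lam (u @` A) = 0.
Proof.
move=> hu A0; apply/eqP; rewrite eq_le outer_measure_ge0 andbT.
have L0 : (0 < `|L| + 1)%R by rewrite ltr_pwDr.
apply: le_trans (@lam_image_le idfun u (`|L| + 1)%R A L0 _) _ => [x y Ax Ay xy|].
  apply: le_trans (hu x y Ax Ay xy) _; rewrite ler_wpM2r ?subr_ge0//.
  by have := ler_norm L; lra.
have -> : lebesgue_stieltjes_measure idfun A = 0 by exact: A0.
by rewrite mule0.
Qed.

Lemma lam_image_itv (u : R -> R) (x y : R) : (x <= y)%R ->
  {within `[x, y], continuous u} -> `|u y - u x|%:E <= lam (u @` `[x, y]).
Proof.
move=> xy cu; have mM : (Num.min (u x) (u y) <= Num.max (u x) (u y))%R.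
  by rewrite ge_min !le_max !lexx.
have -> : `|u y - u x|%:E = lam `[Num.min (u x) (u y), Num.max (u x) (u y)]%classic.
  rewrite lam_itv//; congr EFin; case: (leP (u x) (u y)) => h.
    by rewrite ger0_norm ?subr_ge0.
  by rewrite ltr0_norm ?subr_lt0// opprB.
apply: le_outer_measure => v /=; rewrite in_itv /= => /(IVT xy cu)[c cxy <-].
by exists c.
Qed.

End Images.

(** * The largest slope of a chord: bounds and continuity *)

Definition slope_of (R : realType) (A : R -> R) (x z : R) : R :=
  (A z - A x) / (z - x).

Definition max_slope (R : realType) (a b : R) (A : R -> R) (x : R) : R :=
  sup [set slope_of R A x z | z in [set z | a <= z <= b /\ z != x]].

(* [A] is a primitive of [g], which is only known on the set [G] of sample
   points (the Lebesgue points), of full measure: averages of [g] are compared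
   with its values on [G] through [avg_le] and [avg_ge]. *)
Section MaxSlope.
Context {R : realType} (a b : R) (A g V : R -> R) (G : set R) (B K : R).
Hypothesis ab : a < b.
Hypothesis Gab : forall s, G s -> a < s < b.
Hypothesis avg_le : forall p q c, a <= p -> p < q -> q <= b ->
  (forall s, G s -> p < s < q -> g s <= c) -> A q - A p <= c * (q - p).
Hypothesis avg_ge : forall p q c, a <= p -> p < q -> q <= b ->
  (forall s, G s -> p < s < q -> c <= g s) -> c * (q - p) <= A q - A p.
Hypothesis g_bnd : forall s, G s -> 0 <= g s <= B.
Hypothesis V_bnd : forall s, 0 <= V s <= K.
Hypothesis gV : forall s t, G s -> G t -> s < t -> `|g t - g s| <= V t - V s.

Let slope := slope_of R A.
Let u := max_slope R a b A.

(** Without samples in []p, q[], both average hypotheses would apply vacuously with every constant;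
    the upper bound -1 and the lower bound 1 contradict each other. *)
Lemma sample_dense p q : a <= p -> p < q -> q <= b -> exists2 s, G s & p < s < q.
Proof.
move=> ap pq qb; apply: contrapT => h.
have F (s : R) (P : Prop) : G s -> p < s < q -> P.
  by move=> Gs sp; exfalso; apply: h; exists s.
have h1 := avg_le p q (-1) ap pq qb (fun s Gs sp => F s _ Gs sp).
have h2 := avg_ge p q 1 ap pq qb (fun s Gs sp => F s _ Gs sp).
lra.
Qed.

Lemma density_bound_ge0 : 0 <= B.
Proof.
have [s Gs _] := sample_dense a b (lexx _) ab (lexx _).
by have /andP[h1 h2] := g_bnd s Gs; apply: le_trans h1 h2.
Qed.

Lemma primitive_bnd p q : a <= p -> p <= q -> q <= b -> 0 <= A q - A p <= B * (q - p).
Proof.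
move=> ap; rewrite le_eqVlt => /predU1P[<- _|pq qb].
  by rewrite !subrr mulr0 lexx.
apply/andP; split.
  rewrite -(mul0r (q - p)); apply: avg_ge => // s Gs _.
  by have /andP[] := g_bnd s Gs.
by apply: avg_le => // s Gs _; have /andP[] := g_bnd s Gs.
Qed.

Lemma primitive_absB p q : a <= p <= b -> a <= q <= b ->
  0 <= (A q - A p) * (q - p) /\ `|A q - A p| <= B * `|q - p|.
Proof.
move=> /andP[ap pb] /andP[aq qb]; have [pq|qp] := leP p q.
  have /andP[h1 h2] := primitive_bnd p q ap pq qb.
  rewrite (ger0_norm h1) ger0_norm ?subr_ge0//; split => //.
  by apply: mulr_ge0 => //; rewrite subr_ge0.
have /andP[h1 h2] := primitive_bnd q p aq (ltW qp) pb.
rewrite distrC (distrC q p) (ger0_norm h1) ger0_norm ?subr_ge0 ?(ltW qp)//.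
split => //.
have -> : (A q - A p) * (q - p) = (A p - A q) * (p - q) by ring.
by apply: mulr_ge0 => //; rewrite subr_ge0 ltW.
Qed.

Lemma slopeE x z : z != x -> A z - A x = slope x z * (z - x).
Proof. by move=> zx; rewrite /slope /slope_of mulfVK// subr_eq0. Qed.

Lemma slope_bnd x z : a <= x <= b -> a <= z <= b -> z != x ->
  0 <= slope x z <= B.
Proof.
move=> xab zab zx; have [h1 h2] := primitive_absB x z xab zab.
move: h1 h2; rewrite (slopeE x z zx) -mulrA -expr2 normrM.
have zx2 : 0 < (z - x) ^+ 2 by rewrite exprn_even_gt0// subr_eq0.
have zx1 : 0 < `|z - x| by rewrite normr_gt0 subr_eq0.
rewrite pmulr_lge0// ler_pM2r// => h0.
by rewrite ger0_norm// h0.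
Qed.

Lemma slope_le_max x z : a <= x <= b -> a <= z <= b -> z != x -> slope x z <= u x.
Proof.
move=> xab zab zx; apply: ub_le_sup; last by exists z.
by exists B => _ [w [wab wx] <-]; have /andP[] := slope_bnd x w xab wab wx.
Qed.

Lemma slope_set_neq0 x : a <= x <= b ->
  [set slope_of R A x z | z in [set z | a <= z <= b /\ z != x]] !=set0.
Proof.
move=> /andP[ax xb]; have [xe|xe] := eqVneq x a.
  exists (slope x b), b => //; split; first by rewrite (ltW ab) lexx.
  by rewrite xe gt_eqF.
by exists (slope x a), a => //; split; [rewrite (ltW ab) lexx|rewrite eq_sym].
Qed.

Lemma max_slope_approx x e : a <= x <= b -> 0 < e ->
  exists z, [/\ a <= z <= b, z != x & u x - e < slope x z].
Proof.
move=> xab e0; have hs : has_sup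
    [set slope_of R A x z | z in [set z | a <= z <= b /\ z != x]].
  split; first exact: slope_set_neq0.
  by exists B => _ [w [wab wx] <-]; have /andP[] := slope_bnd x w xab wab wx.
by have [_ [z [zab zx] <-] h] := sup_adherent e0 hs; exists z.
Qed.

Lemma max_slope_bnd x : a <= x <= b -> 0 <= u x <= B.
Proof.
move=> xab; apply/andP; split.
  have [_ [z [zab zx] _]] := slope_set_neq0 x xab.
  have /andP[h _] := slope_bnd x z xab zab zx.
  exact: le_trans (slope_le_max x z xab zab zx).
apply: ge_sup; first exact: slope_set_neq0.
by move=> _ [w [wab wx] <-]; have /andP[] := slope_bnd x w xab wab wx.
Qed.

Lemma max_slope_right x z : a <= x -> x <= z -> z <= b -> A z - A x <= u x * (z - x).
Proof.
move=> ax; rewrite le_eqVlt => /predU1P[->|xz zb]; first by rewrite !subrr mulr0.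
rewrite slopeE ?gt_eqF// ler_pM2r ?subr_gt0//; apply: slope_le_max.
- by rewrite ax (le_trans (ltW xz)).
- by rewrite zb (le_trans ax)// ltW.
- by rewrite gt_eqF.
Qed.

Lemma max_slope_left x z : a <= z -> z <= x -> x <= b -> A x - A z <= u x * (x - z).
Proof.
move=> az; rewrite le_eqVlt => /predU1P[->|zx xb]; first by rewrite !subrr mulr0.
have := slopeE x z (negbT (lt_eqF zx)) => h.
have -> : A x - A z = slope x z * (x - z) by rewrite -opprB h; ring.
rewrite ler_pM2r ?subr_gt0//; apply: slope_le_max.
- by rewrite xb (le_trans az)// ltW.
- by rewrite az (le_trans (ltW zx)).
- by rewrite lt_eqF.
Qed.

Lemma sample_gt p q c : a <= p -> p < q -> q <= b -> c * (q - p) < A q - A p ->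
  exists s, [/\ G s, p < s < q & c < g s].
Proof.
move=> ap pq qb h; apply: contrapT => hn.
have : A q - A p <= c * (q - p).
  apply: avg_le => // s Gs sp; rewrite leNgt; apply/negP => cs.
  by apply: hn; exists s.
by rewrite leNgt h.
Qed.

Lemma pick_slope x z c : a <= x <= b -> a <= z <= b -> z != x ->
  c < slope x z -> exists s, [/\ G s, Num.min x z < s < Num.max x z & c < g s].
Proof.
move=> /andP[ax xb] /andP[az zb] zx cs; have := slopeE x z zx.
case: (ltgtP x z) zx => // [xz|zx] _ E.
  by apply: sample_gt => //; rewrite E ltr_pM2r// subr_gt0.
apply: sample_gt => //.
have -> : A x - A z = slope x z * (x - z) by rewrite -opprB E; ring.
by rewrite ltr_pM2r// subr_gt0.
Qed.

(** The monotone [V] has a limit along the samples decreasing to [x], so just to the right of [x]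
    the samples of [g] differ by at most [e]. A single value above [u x + e] there would keep [g]
    above [u x] all the way to [y1], and the chord from [x] to [y1] would be too steep. *)
Lemma density_le_right x e : a <= x -> x < b -> 0 < e -> exists2 d, 0 < d &
  forall y, G y -> x < y < x + d -> g y <= u x + e.
Proof.
move=> ax xb e0; pose W := [set V y | y in [set y | G y /\ x < y]].
have [y0 Gy0 /andP[xy0 _]] := sample_dense x b ax xb (lexx _).
have hi : has_inf W.
  split; first by exists (V y0), y0.
  by exists 0 => _ [y [Gy _] <-]; have /andP[] := V_bnd y.
have [_ [y1 [Gy1 xy1] <-] Vy1] := inf_adherent e0 hi.
have Vge y : G y -> x < y -> inf W <= V y.
  by move=> Gy xy; apply: ge_inf; [case: hi|exists y].
have /andP[_ y1b] := Gab y1 Gy1.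
exists (y1 - x); first by rewrite subr_gt0.
move=> y Gy; rewrite addrC subrK => /andP[xy yy1]; rewrite leNgt; apply/negP => h.
have : (g y - e) * (y1 - x) <= A y1 - A x.
  apply: avg_ge => //; first exact: ltW.
  move=> s Gs /andP[xs sy1].
  case: (ltgtP s y) => [sy|ys|->]; last by lra.
  - have := gV s y Gs Gy sy; rewrite ler_norml => /andP[_ h1].
    have := gV y y1 Gy Gy1 yy1; rewrite ler_norml => /andP[h2 h2'].
    by have := Vge s Gs xs; lra.
  - have := gV y s Gy Gs ys; rewrite ler_norml => /andP[h1 _].
    have := gV s y1 Gs Gy1 sy1; rewrite ler_norml => /andP[h2 h2'].
    by have := Vge y Gy xy; lra.
have := max_slope_right x y1 ax (ltW xy1) (ltW y1b).
have y1x : 0 < y1 - x by rewrite subr_gt0.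
by move=> h1 h2; have := le_trans h2 h1; rewrite ler_pM2r//; lra.
Qed.

Lemma density_le_left x e : a < x -> x <= b -> 0 < e -> exists2 d, 0 < d &
  forall y, G y -> x - d < y < x -> g y <= u x + e.
Proof.
move=> ax xb e0; pose W := [set V y | y in [set y | G y /\ y < x]].
have [y0 Gy0 /andP[_ xy0]] := sample_dense a x (lexx _) ax xb.
have hi : has_sup W.
  split; first by exists (V y0), y0.
  by exists K => _ [y [Gy _] <-]; have /andP[] := V_bnd y.
have [_ [y1 [Gy1 xy1] <-] Vy1] := sup_adherent e0 hi.
have Vge y : G y -> y < x -> V y <= sup W.
  by move=> Gy xy; apply: ub_le_sup; [case: hi|exists y].
have /andP[ay1 _] := Gab y1 Gy1.
exists (x - y1); first by rewrite subr_gt0.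
move=> y Gy; rewrite subKr => /andP[yy1 xy]; rewrite leNgt; apply/negP => h.
have : (g y - e) * (x - y1) <= A x - A y1.
  apply: avg_ge => //; first exact: ltW.
  move=> s Gs /andP[sy1 xs].
  case: (ltgtP s y) => [sy|ys|->]; last by lra.
  - have := gV s y Gs Gy sy; rewrite ler_norml => /andP[_ h1].
    have := gV y1 s Gy1 Gs sy1; rewrite ler_norml => /andP[h2 h2'].
    by have := Vge y Gy xy; lra.
  - have := gV y s Gy Gs ys; rewrite ler_norml => /andP[h1 _].
    have := gV y1 y Gy1 Gy yy1; rewrite ler_norml => /andP[h2 h2'].
    by have := Vge s Gs xs; lra.
have := max_slope_left x y1 (ltW ay1) (ltW xy1) xb.
have y1x : 0 < x - y1 by rewrite subr_gt0.
by move=> h1 h2; have := le_trans h2 h1; rewrite ler_pM2r//; lra.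
Qed.

(** The far end [z] of the chord is kept while [x] moves to [y]. In the identity [E] both terms on
    the right have the sign of [y - x] and size at most [B * |y - x|], hence so is the size of their
    difference; the new chord has length at least [r / 2], whence [2 * B / r]. *)
Lemma slope_lip x y z r : a <= x <= b -> a <= y <= b -> a <= z <= b -> 0 < r ->
  r <= `|z - x| -> `|y - x| <= r / 2 ->
  z != y /\ slope x z - 2 * B / r * `|y - x| <= slope y z.
Proof.
move=> xab yab zab r0 rzx yxr.
have zy2 : r / 2 <= `|z - y|.
  have := ler_distD y z x; rewrite -(distrC x y) in yxr * => h.
  by have := distrC x y; lra.
have zy : z != y.
  by rewrite -subr_eq0 -normr_gt0; apply: lt_le_trans zy2; rewrite divr_gt0.
have zx : z != x.
  by rewrite -subr_eq0 -normr_gt0; apply: lt_le_trans rzx.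
split=> //.
have [k1 k2] := primitive_absB x y xab yab.
have /andP[s0 sB] := slope_bnd x z xab zab zx.
set s := slope x z in s0 sB *; set t := slope y z.
have E : (t - s) * (z - y) = s * (y - x) - (A y - A x).
  have h1 : A z - A x = s * (z - x) := slopeE x z zx.
  have h2 : A z - A y = t * (z - y) := slopeE y z zy.
  have h3 : s * (z - y) = s * (z - x) - s * (y - x) by ring.
  by rewrite mulrBl -h2 h3 -h1; ring.
have E2 : `|t - s| * `|z - y| <= B * `|y - x|.
  rewrite -normrM E; have B0 := density_bound_ge0; have [xy|yx] := leP x y.
    move: k1 k2; rewrite (ger0_norm (_ : 0 <= y - x)) ?subr_ge0// => k1 k2.
    move: k2; rewrite !ler_norml => /andP[k3 k4].
    have [->|xy'] := eqVneq x y; first by rewrite !subrr !mulr0 subrr oppr0 lexx.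
    have yx0 : 0 < y - x by rewrite subr_gt0 lt_neqAle xy' xy.
    move: k1; rewrite pmulr_lge0// => k1.
    have : s * (y - x) <= B * (y - x) by rewrite ler_pM2r.
    have : 0 <= s * (y - x) by rewrite mulr_ge0// ltW.
    by lra.
  have yx0 : 0 < x - y by rewrite subr_gt0.
  rewrite -normrN (distrC y x) (ger0_norm (ltW yx0)).
  move: k1 k2; have -> : (A y - A x) * (y - x) = (A x - A y) * (x - y) by ring.
  rewrite pmulr_lge0// (distrC (A y)) (distrC y) (ger0_norm (ltW yx0)) => k1 k2.
  move: k2; rewrite !ler_norml => /andP[k3 k4].
  have : s * (x - y) <= B * (x - y) by rewrite ler_pM2r.
  have : 0 <= s * (x - y) by rewrite mulr_ge0// ltW.
  by lra.
have : `|t - s| * (r / 2) <= B * `|y - x|.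
  by apply: le_trans E2; rewrite ler_wpM2l.
have -> : 2 * B / r * `|y - x| = (B * `|y - x|) / (r / 2).
  by field; rewrite gt_eqF.
have r2 : 0 < r / 2 by rewrite divr_gt0.
rewrite -ler_pdivlMr//; set w := _ / (r / 2).
by rewrite ler_norml => /andP[h _]; lra.
Qed.


(** A nearly steepest chord from [x] stays nearly as steep when only its end at [x] moves. The
    denominator [4 * B + 1] makes the loss at most [e / 2], and is positive even for [B = 0]. *)
Lemma max_slope_lsc x e : a <= x <= b -> 0 < e -> exists2 d, 0 < d &
  forall y, a <= y <= b -> `|y - x| <= d -> u x - e <= u y.
Proof.
move=> xab e0; have e2 : 0 < e / 2 by lra.
have [z [zab zx hz]] := max_slope_approx x (e / 2) xab e2.
have B0 := density_bound_ge0; set r := `|z - x|.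
have r0 : 0 < r by rewrite normr_gt0 subr_eq0.
exists (Num.min (r / 2) (e * r / (4 * B + 1))).
  by rewrite lt_min divr_gt0//= divr_gt0 ?mulr_gt0//; lra.
move=> y yab; rewrite le_min => /andP[yx1 yx2].
have [zy h] := slope_lip x y z r xab yab zab r0 (lexx _) yx1.
have h2 := slope_le_max y z yab zab zy.
suff : 2 * B / r * `|y - x| <= e / 2 by lra.
rewrite mulrAC ler_pdivrMr//.
move: yx2; rewrite ler_pdivlMr; last by lra.
by have := normr_ge0 (y - x); nra.
Qed.

(** Suppose a chord from [y] near [x] is steeper than [u x + e / 2]. If it reaches far from [x], it
    can be moved to [x]. Otherwise it lies where the samples of [g], except possibly at [x], are at
    most [u x + e / 2]. *)
Lemma max_slope_usc x e : a <= x <= b -> 0 < e -> exists2 d, 0 < d &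
  forall y, a <= y <= b -> `|y - x| <= d -> u y <= u x + e.
Proof.
move=> xab e0; have /andP[ax xb] := xab; have e2 : 0 < e / 2 by lra.
have e4 : 0 < e / 4 by lra.
have [r r0 gr] : exists2 r, 0 < r &
    forall s, G s -> s != x -> `|s - x| < r -> g s <= u x + e / 2.
  have [r1 r10 h1] : exists2 r, 0 < r &
      forall s, G s -> x < s < x + r -> g s <= u x + e / 2.
    have [xb'|xb'] := ltP x b; first exact: density_le_right.
    by exists 1 => // s Gs; have := Gab s Gs; lra.
  have [r2 r20 h2] : exists2 r, 0 < r &
      forall s, G s -> x - r < s < x -> g s <= u x + e / 2.
    have [xb'|xb'] := ltP a x; first exact: density_le_left.
    by exists 1 => // s Gs; have := Gab s Gs; lra.
  exists (Num.min r1 r2); first by rewrite lt_min r10.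
  move=> s Gs sx; rewrite lt_min !ltr_norml => /andP[/andP[k1 k2] /andP[k3 k4]].
  case: (ltgtP x s) sx => // [xs|sx] _; first by apply: h1 => //; lra.
  by apply: h2 => //; lra.
have B0 := density_bound_ge0.
exists (Num.min (r / 4) (e * (r / 2) / (4 * B + 1))).
  by rewrite lt_min divr_gt0//= divr_gt0 ?mulr_gt0//; lra.
move=> y yab; rewrite le_min => /andP[yx1 yx2].
rewrite leNgt; apply/negP => ux.
have [z [zab zy hz]] := max_slope_approx y (e / 4) yab e4.
have hz' : u x + e / 2 < slope y z by lra.
have [zxr|zxr] := ltP `|z - x| r; last first.
  have xyr : `|x - y| <= r / 2 / 2 by rewrite distrC; lra.
  have zyr : r / 2 <= `|z - y|.
    by have := ler_distD y z x; lra.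
  have [zx h] := slope_lip y x z (r / 2) yab xab zab ltac:(lra) zyr xyr.
  have h2 := slope_le_max x z xab zab zx.
  suff : 2 * B / (r / 2) * `|x - y| <= e / 2 by move=> h3; lra.
  rewrite mulrAC ler_pdivrMr; last by lra.
  move: yx2; rewrite distrC ler_pdivlMr; last by lra.
  by have := normr_ge0 (x - y); nra.
have yxr : `|y - x| < r by lra.
move: zxr yxr; rewrite !ltr_norml => /andP[z1 z2] /andP[y1 y2].
have [s [Gs sm gs]] := pick_slope y z (u x + e / 2) yab zab zy hz'.
have /andP[ay yb] := yab; have /andP[az zb] := zab.
(* The local bound on [g] leaves [x] itself as the only possible high sample. Then [x] lies inside
   the chord and splits it into two chords from [x], so its slope is a mean of two slopes at most
   [u x]. *)
suff [] : ~ (g s <= u x + e / 2) /\ s = x.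
  move=> h sx; case: (ltgtP y z) zy sm => // [yz|zy] _ /andP[s1 s2].
  - have h1 := max_slope_right x z ax ltac:(lra) zb.
    have h2 := max_slope_left x y ay ltac:(lra) xb.
    have h3 := slopeE y z (negbT (gt_eqF yz)).
    have h4 : slope y z * (z - y) <= u x * (z - y) by rewrite -h3; lra.
    by move: h4; rewrite ler_pM2r; lra.
  - have h1 := max_slope_right x y ax ltac:(lra) yb.
    have h2 := max_slope_left x z az ltac:(lra) xb.
    have h3 := slopeE y z (negbT (lt_eqF zy)).
    have h4 : slope y z * (y - z) <= u x * (y - z).
      have -> : slope y z * (y - z) = - (slope y z * (z - y)) by ring.
      by rewrite -h3; lra.
    by move: h4; rewrite ler_pM2r; lra.
split; first by lra.
apply/eqP; apply: contraT => sx; have /(_ _)/le_lt_trans/(_ gs) := gr s Gs sx.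
rewrite ltxx; apply; rewrite ltr_norml; move: sm.
by case: (ltgtP y z) zy => // [yz|zy'] _ /andP[]; lra.
Qed.

Lemma max_slope_cont x e : a <= x <= b -> 0 < e -> exists2 d, 0 < d &
  forall y, a <= y <= b -> `|y - x| <= d -> `|u y - u x| <= e.
Proof.
move=> xab e0.
have [d1 d10 h1] := max_slope_lsc x e xab e0; have [d2 d20 h2] := max_slope_usc x e xab e0.
exists (Num.min d1 d2); first by rewrite lt_min d10.
move=> y yab; rewrite le_min => /andP[k1 k2].
by have := h1 y yab k1; have := h2 y yab k2; rewrite ler_norml; lra.
Qed.

(** * Variation of the largest slope *)

Fixpoint list_variation (f : R -> R) (x : R) (s : seq R) : R :=
  if s is y :: s' then `|f y - f x| + list_variation f y s' else 0.

(* [S] is the variation of [u] up to [x]. The first invariant controls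
   a continuation by an increase of [u], the second by a decrease: a drop of
   [u] forces a high sample value of [g] before the lower point. *)
Lemma max_slope_variation_rec s x S : a <= x -> x < b -> path <%R x s -> last x s <= b ->
  (forall y, G y -> x < y -> S - u x <= V y - g y) ->
  (forall y, x < y -> y <= b -> u y < u x -> forall e, 0 < e ->
     exists q, [/\ G q, q < y & S + u x <= V q + g q + e]) ->
  S + list_variation u x s <= K + 2 * B.
Proof.
elim: s x S => [|y s ih] x S ax xb /=.
  move=> _ _ hL _; have [q Gq /andP[xq qb]] := sample_dense x b ax xb (lexx _).
  have := hL q Gq xq; have := V_bnd q; have := g_bnd q Gq.
  have := max_slope_bnd x; rewrite ax (ltW xb) => /(_ isT); have := density_bound_ge0; lra.
move=> /andP[xy ys] lb hL hH.
have yb : y <= b.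
  apply: le_trans lb; elim: s y ys {ih hH xy} => //= z s ih y /andP[yz zs].
  exact: le_trans (ltW yz) (ih z zs).
have xab : a <= x <= b by rewrite ax ltW.
have yab : a <= y <= b by rewrite yb (le_trans ax (ltW xy)).
have := max_slope_bnd x xab; have := max_slope_bnd y yab => /andP[uy0 uyB] /andP[ux0 uxB].
case: (ltgtP y b) yb => // [yb|yb] _; last first.
  have -> : s = [::].
    case: s ys lb {ih} => //= z s /andP[yz zs] lb; exfalso.
    suff : z <= last z s by move: lb yb yz; lra.
    elim: s z zs {yz lb} => //= w s ih z /andP[zw ws].
    exact: le_trans (ltW zw) (ih w ws).
  (* No sample lies beyond [b], so the invariants cannot be carried to [y = b]. The first one at [x]
     gives [S <= K + B], and the last increment is bounded crudely by another [B]: this is the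
     [2 * B] of the conclusion. *)
  rewrite /= addr0; have [q Gq /andP[xq qb]] := sample_dense x b ax xb (lexx _).
  have := hL q Gq xq; have := V_bnd q; have := g_bnd q Gq.
  have : `|u y - u x| <= B by rewrite ler_norml; lra.
  by lra.
rewrite addrA; apply: ih => //; first by case/andP: yab.
- move=> t Gt yt; have [uxy|uyx] := leP (u x) (u y).
    rewrite ger0_norm ?subr_ge0//.
    by have := hL t Gt (lt_trans xy yt); lra.
  rewrite ler0_norm ?subr_le0 ?(ltW uyx)//; apply/ler_addgt0Pr => e e0.
  have e3 : 0 < e / 3 by lra.
  (* The drop at [y] is paid for by [V] between a high sample [q] before [y] and a sample [t'] just
     after [y], where [g] is at most [u y + e / 3]: from [q] to [t'], [V] grows by at least
     [g q - g t']. *)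
  have [q [Gq qy hq]] := hH y xy (ltW yb) uyx (e / 3) e3.
  have [d d0 gd] := density_le_right y (e / 3) ltac:(by case/andP: yab) yb e3.
  have [t' Gt' t'y] := sample_dense y (Num.min t (y + d)) ltac:(by case/andP: yab)
     ltac:(by rewrite lt_min yt; lra)
     ltac:(by rewrite ge_min; have := Gab t Gt => /andP[_ /ltW ->]).
  move: t'y; rewrite lt_min => /and3P[yt' t't t'd].
  have h1 := gd t' Gt' ltac:(lra).
  have := gV q t' Gq Gt' (lt_trans qy yt').
  have := gV t' t Gt' Gt t't.
  by rewrite !ler_norml; lra.
- move=> z yz zb uzy e e0; have [uyx|uxy] := leP (u y) (u x).
    have [uzx|] := ltP (u y) (u x).
      have [q [Gq qy hq]] := hH y xy (ltW yb) uzx e e0.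
      exists q; split => //; first exact: lt_trans yz.
      by rewrite ler0_norm ?subr_le0//; lra.
    move=> uxy; have E : u y = u x by apply/eqP; rewrite eq_le uyx.
    have [q [Gq qy hq]] := hH z (lt_trans xy yz) zb ltac:(by rewrite -E) e e0.
    by exists q; split => //; rewrite E subrr normr0; lra.
  rewrite ger0_norm ?subr_ge0 ?(ltW uxy)//.
  (* This makes the chord from [y] steeper than both [u x] and [u z]. It can then contain neither
     [x] nor [z], since the part beyond such a point and the part back to [y] are both chords from
     that point; so the high sample [q] lies between [x] and [z]. *)
  pose e' := Num.min (e / 2) (Num.min (u y - u x) (u y - u z)).
  have e'0 : 0 < e' by rewrite !lt_min !subr_gt0 uxy uzy andbT; lra.
  have [w [wab wy hw]] := max_slope_approx y e' yab e'0.
  have [e1 [e2 e3]] : e' <= e / 2 /\ e' <= u y - u x /\ e' <= u y - u z.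
    by rewrite /e' !ge_min !lexx !orbT.
  have hw1 : u x < slope y w by lra.
  have hw2 : u z < slope y w by lra.
  have /andP[ay _] := yab; have /andP[aw wb] := wab.
  have [q [Gq qm gq]] := pick_slope y w (u y - e') yab wab wy hw.
  have [xq qz] : x < q /\ q < z.
    case: (ltgtP y w) wy qm => // [yw|wy] _ /andP[q1 q2].
    - split; first by lra.
      apply: contraT; rewrite -leNgt => zq.
      have h1 := max_slope_left z y ay (ltW yz) zb.
      have h2 := max_slope_right z w ltac:(lra) ltac:(lra) wb.
      have h3 := slopeE y w (negbT (gt_eqF yw)).
      have h4 : slope y w * (w - y) <= u z * (w - y) by rewrite -h3; lra.
      by move: h4; rewrite ler_pM2r; lra.
    - split; last by lra.
      apply: contraT; rewrite -leNgt => zq.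
      have h1 := max_slope_right x y ax (ltW xy) (ltW yb).
      have h2 := max_slope_left x w aw ltac:(lra) (ltW xb).
      have h3 := slopeE y w (negbT (lt_eqF wy)).
      have h4 : slope y w * (y - w) <= u x * (y - w).
        have -> : slope y w * (y - w) = - (slope y w * (w - y)) by ring.
        by rewrite -h3; lra.
      by move: h4; rewrite ler_pM2r; lra.
  by exists q; split => //; have := hL q Gq xq; lra.
Qed.

(** At [a] the invariants hold with [S = 0]: samples just after [a] are at most [u a + e], a steep
    chord from [a] has a sample above [u a - e] under it, and [V] is nonnegative. *)
Lemma max_slope_variation s : path <%R a s -> last a s <= b ->
  list_variation u a s <= K + 2 * B.
Proof.
move=> as_ lb; have B0 := density_bound_ge0; rewrite -[leLHS]add0r.
apply: max_slope_variation_rec => //.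
- move=> y Gy ay; rewrite sub0r; apply/ler_addgt0Pr => e e0.
  have [d d0 gd] := density_le_right a e (lexx _) ab e0.
  have [t Gt] := sample_dense a (Num.min y (a + d)) (lexx _)
     ltac:(by rewrite lt_min ay; lra)
     ltac:(by rewrite ge_min; have := Gab y Gy => /andP[_ /ltW ->]).
  rewrite lt_min => /and3P[at_ ty td].
  have h1 := gd t Gt ltac:(lra); have := V_bnd t.
  by have := gV t y Gt Gy ty; rewrite ler_norml; lra.
- move=> y ay yb uya e e0; rewrite add0r.
  pose e' := Num.min e (u a - u y).
  have e'0 : 0 < e' by rewrite !lt_min !subr_gt0 uya e0.
  have aab : a <= a <= b by rewrite lexx ltW.
  have [w [wab wy hw]] := max_slope_approx a e' aab e'0.
  have [e1 e2] : e' <= e /\ e' <= u a - u y by rewrite /e' !ge_min !lexx !orbT.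
  have hw2 : u y < slope a w by lra.
  have /andP[aw wb] := wab.
  have aw' : a < w by rewrite lt_neqAle eq_sym wy.
  have [q [Gq qm gq]] := pick_slope a w (u a - e') aab wab wy hw.
  exists q; move: qm; rewrite min_l// max_r// => /andP[q1 q2]; split => //.
    apply: contraT; rewrite -leNgt => zq.
    have h1 := max_slope_left y a (lexx _) (ltW ay) yb.
    have h2 := max_slope_right y w ltac:(lra) ltac:(lra) wb.
    have h3 := slopeE a w (negbT (gt_eqF aw')).
    have h4 : slope a w * (w - a) <= u y * (w - a) by rewrite -h3; lra.
    by move: h4; rewrite ler_pM2r; lra.
  by have := V_bnd q; lra.
Qed.


(** * Images of null sets under the largest slope *)

Definition near_maximal (h x : R) := forall e, 0 < e ->
  exists z, [/\ a <= z <= b, z != x, `|z - x| < h & u x - e < slope x z].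

(* If the slopes at [x] near [u x] are all taken at distance at least [h], they
   are nearly slopes at [y] too. *)
Lemma far_lip h x y : 0 < h -> a <= x <= b -> a <= y <= b ->
  ~ near_maximal h x -> u x - 2 * B / h * `|y - x| <= u y.
Proof.
move=> h0 xab yab /existsNP[e /not_implyP[e0 hn]].
have B0 := density_bound_ge0.
have c0 : 0 <= 2 * B / h by rewrite divr_ge0// ?mulr_ge0// ltW.
have [yxh|yxh] := leP `|y - x| (h / 2); last first.
  have : 2 * B / h * (h / 2) <= 2 * B / h * `|y - x| by rewrite ler_wpM2l// ltW.
  have -> : 2 * B / h * (h / 2) = B by field; rewrite gt_eqF.
  set w := 2 * B / h * _.
  by have := max_slope_bnd x xab; have := max_slope_bnd y yab; lra.
apply/ler_addgt0Pr => e' e'0.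
have e20 : 0 < Num.min e e' by rewrite lt_min e0.
have [z [zab zx hz]] := max_slope_approx x _ xab e20.
have [zxh|zxh] := ltP `|z - x| h.
  exfalso; apply: hn; exists z; split => //.
  have : Num.min e e' <= e by rewrite ge_min lexx.
  by lra.
have [zy h1] := slope_lip x y z h xab yab zab h0 zxh yxh.
have h2 := slope_le_max y z yab zab zy.
have : Num.min e e' <= e' by rewrite ge_min lexx orbT.
move: h1; set w := 2 * B / h * _; lra.
Qed.

Lemma near_pick h x e : 0 < e -> a <= x <= b -> near_maximal h x ->
  exists s, [/\ G s, x - h < s, s < x + h & u x - e < g s].
Proof.
move=> e0 xab /(_ e e0)[z [zab zx zh hz]].
have [s [Gs sm gs]] := pick_slope x z (u x - e) xab zab zx hz.
exists s; move: zh sm; rewrite ltr_norml => /andP[z1 z2].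
by case: (ltgtP x z) zx => // _ _ /andP[s1 s2]; split => //; lra.
Qed.

(* As [g] is almost increasing, it stays above [u y - e - E] on
   [[c + 2 * h, c + 3 * h]], hence so does the slope from [x] to [c + 3 * h] up
   to the weight 1/3 of that interval. *)
Lemma near_incr c h E x y : 0 < h -> a <= c - h -> c + 3 * h <= b -> 0 <= E ->
  (forall s t, G s -> G t -> c - h < s -> s < t -> t < c + 3 * h -> g s <= g t + E) ->
  c <= x <= c + h -> c <= y <= c + h ->
  near_maximal h x -> near_maximal h y -> u y <= u x + 3 * E.
Proof.
move=> h0 ach chb E0 inc /andP[cx xc] /andP[cy yc] nx ny.
have xab : a <= x <= b by lra.
have yab : a <= y <= b by lra.
suff main e : 0 < e -> h * (u y - u x) <= 3 * h * (e + E).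
  apply/ler_addgt0Pr => e e0; have e3 : 0 < e / 3 by lra.
  have := main (e / 3) e3; have -> : 3 * h * (e / 3 + E) = h * (e + 3 * E) by field.
  by rewrite ler_pM2l//; lra.
move=> e0.
have Hy : (u y - e - E) * h <= A (c + 3 * h) - A (c + 2 * h).
  have [s [Gs s1 s2 gs]] := near_pick h y e e0 yab ny.
  have -> : (u y - e - E) * h = (u y - e - E) * (c + 3 * h - (c + 2 * h)) by ring.
  apply: avg_ge => //; [lra|lra|] => t Gt /andP[t1 t2].
  by have := inc s t Gs Gt ltac:(lra) ltac:(lra) t2; lra.
have Hx : (u x - e - E) * (c + 2 * h - x) <= A (c + 2 * h) - A x.
  have [z [zab zx zh hz]] := nx e e0.
  have [s [Gs sm gs]] := pick_slope x z (u x - e) xab zab zx hz.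
  have Az := slopeE x z zx; have /andP[az zb] := zab.
  move: zh; rewrite ltr_norml => /andP[z1 z2].
  case: (ltgtP x z) zx sm => // [xz|zx] _ /andP[s1 s2].
  - have k1 : (u x - e - E) * (c + 2 * h - z) <= A (c + 2 * h) - A z.
      apply: avg_ge => //; [lra|lra|] => t Gt /andP[t1 t2].
      by have := inc s t Gs Gt ltac:(lra) ltac:(lra) ltac:(lra); lra.
    have k2 : (u x - e - E) * (z - x) <= A z - A x.
      by rewrite Az ler_pM2r; lra.
    by lra.
  - apply: avg_ge => //; [lra|lra|lra|] => t Gt /andP[t1 t2].
    by have := inc s t Gs Gt ltac:(lra) ltac:(lra) ltac:(lra); lra.
have Hu : A (c + 3 * h) - A x <= u x * (c + 3 * h - x) by apply: max_slope_right; lra.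
have : (e + E) * (c + 3 * h - x) <= (e + E) * (3 * h) by rewrite ler_pM2l; lra.
by lra.
Qed.

(** Reflection of [near_incr]: the comparison chord from [x] goes left to [c - 2 * h], and
    [[c - 2 * h, c - h]] is at least a third of it. *)
Lemma near_decr c h E x y : 0 < h -> a <= c - 2 * h -> c + 2 * h <= b -> 0 <= E ->
  (forall s t, G s -> G t -> c - 2 * h < s -> s < t -> t < c + 2 * h ->
     g t <= g s + E) ->
  c <= x <= c + h -> c <= y <= c + h ->
  near_maximal h x -> near_maximal h y -> u y <= u x + 3 * E.
Proof.
move=> h0 ach chb E0 inc /andP[cx xc] /andP[cy yc] nx ny.
have xab : a <= x <= b by lra.
have yab : a <= y <= b by lra.
suff main e : 0 < e -> h * (u y - u x) <= 3 * h * (e + E).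
  apply/ler_addgt0Pr => e e0; have e3 : 0 < e / 3 by lra.
  have := main (e / 3) e3; have -> : 3 * h * (e / 3 + E) = h * (e + 3 * E) by field.
  by rewrite ler_pM2l//; lra.
move=> e0.
have Hy : (u y - e - E) * h <= A (c - h) - A (c - 2 * h).
  have [s [Gs s1 s2 gs]] := near_pick h y e e0 yab ny.
  have -> : (u y - e - E) * h = (u y - e - E) * (c - h - (c - 2 * h)) by ring.
  apply: avg_ge => //; [lra|lra|] => t Gt /andP[t1 t2].
  by have := inc t s Gt Gs t1 ltac:(lra) ltac:(lra); lra.
have Hx : (u x - e - E) * (x - (c - h)) <= A x - A (c - h).
  have [z [zab zx zh hz]] := nx e e0.
  have [s [Gs sm gs]] := pick_slope x z (u x - e) xab zab zx hz.
  have Az := slopeE x z zx; have /andP[az zb] := zab.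
  move: zh; rewrite ltr_norml => /andP[z1 z2].
  case: (ltgtP x z) zx sm => // [xz|zx] _ /andP[s1 s2].
  - apply: avg_ge => //; [lra|lra|lra|] => t Gt /andP[t1 t2].
    by have := inc t s Gt Gs ltac:(lra) ltac:(lra) ltac:(lra); lra.
  - have k1 : (u x - e - E) * (z - (c - h)) <= A z - A (c - h).
      apply: avg_ge => //; [lra|lra|] => t Gt /andP[t1 t2].
      by have := inc t s Gt Gs ltac:(lra) ltac:(lra) ltac:(lra); lra.
    have k2 : (u x - e - E) * (x - z) <= A x - A z.
      have -> : A x - A z = slope x z * (x - z) by rewrite -opprB Az; ring.
      by rewrite ler_pM2r; lra.
    by lra.
have Hu : A x - A (c - 2 * h) <= u x * (x - (c - 2 * h)) by apply: max_slope_left; lra.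
have : (e + E) * (x - (c - 2 * h)) <= (e + E) * (3 * h) by rewrite ler_pM2l; lra.
by lra.
Qed.


(* The cells have length [h] and their windows overlap at most five times, so
   the bounds [Xu] telescope; two end pieces of length [2 * h] remain, with
   small image by continuity. *)
Lemma lam_image_gap (N : set R) (p q : R) (X : R -> R) :
  lam N = 0%E -> a <= p -> p < q -> q <= b ->
  (forall x y, p <= x -> x <= y -> y <= q -> X x <= X y) ->
  (forall c h x y, 0 < h -> p <= c - 2 * h -> c + 3 * h <= q ->
     c <= x <= c + h -> c <= y <= c + h ->
     near_maximal h x -> near_maximal h y ->
     u y <= u x + 3 * (X (c + 3 * h) - X (c - 2 * h))) ->
  (lam (u @` (N `&` `[p, q]%classic)) <= (15 * (X q - X p))%:E)%E.
Proof.
move=> N0 ap pq qb Xnd Xu; apply/lee_addgt0Pr => e e0.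
have e4 : 0 < e / 4 by lra.
have pab : a <= p <= b by rewrite ap (le_trans (ltW pq)).
have qab : a <= q <= b by rewrite qb (le_trans ap (ltW pq)).
have [d1 d10 hd1] := max_slope_cont p (e / 4) pab e4.
have [d2 d20 hd2] := max_slope_cont q (e / 4) qab e4.
have qp0 : 0 < q - p by rewrite subr_gt0.
pose d := Num.min d1 d2.
have d0 : 0 < d by rewrite lt_min d10.
pose m := Num.bound (2 * (q - p) / d).
have hm : 2 * (q - p) / d < m%:R.
  by apply: archi_boundP; rewrite divr_ge0// ?mulr_ge0// ltW.
(* Cell [j] is [[p + (j + 2) * h, p + (j + 3) * h]] and its window is
   [[p + j * h, p + (j + 5) * h]]. With [m + 4] steps from [p] to [q], the window of the last of the
   [m] cells ends exactly at [q]. *)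
pose M : R := (m + 4)%:R.
have M0 : 0 < M by rewrite ltr0n addn_gt0 orbT.
pose h := (q - p) / M.
have h0 : 0 < h by rewrite divr_gt0.
have hM : M * h = q - p by rewrite /h mulrC mulfVK// gt_eqF.
have h4 : 4 * h <= q - p by rewrite -hM ler_wpM2r ?(ltW h0)// ler_nat leq_addl.
have hd : 2 * h <= d.
  move: hm; rewrite ltr_pdivrMr// => hm.
  have k1 : m%:R * d <= M * d by rewrite ler_wpM2r ?(ltW d0)// ler_nat leq_addr.
  by rewrite -(ler_pM2l M0) mulrCA hM; lra.
have [dd1 dd2] : d <= d1 /\ d <= d2 by rewrite /d !ge_min !lexx orbT.
pose cell j := [set x | [/\ near_maximal h x, p + (j.+2)%:R * h <= x &
                       x <= p + (j.+3)%:R * h]].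
pose far := [set x | a <= x <= b /\ ~ near_maximal h x].
have sub : u @` (N `&` `[p, q]) `<=`
    (u @` (N `&` far)) `|` ((u @` `[p, p + 2 * h]) `|` (u @` `[q - 2 * h, q])) `|`
    \big[setU/set0]_(j < m) (u @` cell j).
  move=> _ [x [Nx /=]] + <-; rewrite in_itv /= => /andP[px xq].
  have [nx|fx] := pselect (near_maximal h x); last first.
    by left; left; exists x => //; split => //; split => //; lra.
  have [xp2|xp2] := leP x (p + 2 * h).
    by left; right; left; exists x => //=; rewrite in_itv /= px.
  have [xq2|xq2] := leP (q - 2 * h) x.
    by left; right; right; exists x => //=; rewrite in_itv /= xq xq2.
  right; rewrite -(bigcup_mkord m (fun j => u @` cell j)); pose t := (x - p) / h - 2.
  have ht : t * h = x - p - 2 * h by rewrite /t mulrBl mulfVK// gt_eqF.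
  have t0 : 0 <= t by rewrite -(pmulr_lge0 _ h0) ht; lra.
  have tm : t < m%:R.
    by rewrite -(ltr_pM2r h0) ht; move: hM; rewrite /M natrD => hM; lra.
  have /andP[t1 t2] := truncn_itv t0.
  have jm : (Num.truncn t < m)%N by rewrite -(@ltr_nat R) (le_lt_trans t1).
  exists (Num.truncn t) => //=; exists x => //; split => //.
    rewrite -[j in j.+2]addn0 -addnS -addnS natrD; move: t1; rewrite -(ler_pM2r h0) ht; lra.
  by move: t2; rewrite -(ltr_pM2r h0) ht -!(addn1 (Num.truncn t)) !natrD; lra.
apply: le_trans (le_outer_measure lam _ _ sub) _.
apply: le_trans (outer_measureU2 lam _ _) _.
rewrite addeC; apply: leeD.
- apply: le_trans (outer_measure_subadditive lam (fun j => u @` cell j) m) _.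
  pose Y i := X (p + i%:R * h).
  have cellE j : (j < m)%N -> (lam (u @` cell j) <= (3 * (Y (j + 5)%N - Y j))%:E)%E.
    move=> jm.
    have j5 : p + (j + 5)%:R * h <= q.
      have -> : q = p + M * h by rewrite hM; ring.
      by rewrite lerD2l ler_wpM2r ?(ltW h0)// ler_nat addnS -addSn leq_add2r.
    have E c : (j + c)%:R = j%:R + c%:R :> R by rewrite natrD.
    have jh : 0 <= j%:R * h by rewrite mulr_ge0// ltW.
    apply: lam_diam.
      rewrite mulr_ge0// subr_ge0; apply: Xnd => //; first by lra.
      by rewrite lerD2l ler_wpM2r ?(ltW h0)// ler_nat leq_addr.
    move=> _ _ [x [nx x1 x2] <-] [y [ny y1 y2] <-].
    have := Xu (p + (j + 2)%:R * h) h y x h0.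
    rewrite /Y; move: j5 x1 x2 y1 y2.
    have -> : j.+2%:R = j%:R + 2 :> R by rewrite -addn2 natrD.
    have -> : j.+3%:R = j%:R + 3 :> R by rewrite -addn3 natrD.
    rewrite !E => j5 x1 x2 y1 y2.
    have -> : p + (j%:R + 2) * h + 3 * h = p + (j%:R + 5) * h by ring.
    have -> : p + (j%:R + 2) * h - 2 * h = p + j%:R * h by ring.
    by move=> /(_ ltac:(lra) j5 ltac:(lra) ltac:(lra) ny nx); lra.
  apply: (@le_trans _ _ (\sum_(j < m) (3 * (Y (j + 5)%N - Y j)))%:E).
    by rewrite -sumEFin; apply: lee_sum => j _; exact: cellE.
  rewrite lee_fin -mulr_sumr.
  (* Telescoping with shift 5 leaves five increments, each at most [X q - X p]; with the factor 3 of
     the oscillation bound this gives 15. *)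
  have -> : \sum_(j < m) (Y (j + 5)%N - Y j) = \sum_(i < 5) (Y (m + i)%N - Y i).
    elim: m {hm M M0 h h0 hM hd h4 cell far sub cellE} Y => [|m ih] Y.
      by rewrite big_ord0 big1// => i _; rewrite add0n subrr.
    rewrite big_ord_recr /= ih !big_ord_recr !big_ord0 /= !addn0 !addSn !addnS !addn0.
    by ring.
  have YM i j : (i <= j)%N -> (j <= m + 4)%N -> Y i <= Y j.
    move=> ij jm; apply: Xnd.
    - by rewrite lerDl mulr_ge0// ltW.
    - by rewrite lerD2l ler_wpM2r ?(ltW h0)// ler_nat.
    - have -> : q = p + M * h by rewrite hM; ring.
      by rewrite lerD2l ler_wpM2r ?(ltW h0)// ler_nat.
  have Y0 : Y 0%N = X p by rewrite /Y mul0r addr0.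
  have Ym : Y (m + 4)%N = X q by rewrite /Y -/M hM addrC subrK.
  have : \sum_(i < 5) (Y (m + i)%N - Y i) <= \sum_(i < 5) (X q - X p).
    apply: ler_sum => i _; rewrite -Y0 -Ym; apply: lerB; apply: YM => //.
      by rewrite leq_add2l -ltnS.
    by rewrite (leq_trans _ (leq_addl _ _))// -ltnS.
  by rewrite sumr_const card_ord -mulr_natl; lra.
- apply: le_trans (outer_measureU2 lam _ _) _.
  have -> : lam (u @` (N `&` far)) = 0%E.
    apply: (@lam_image_null R u (2 * B / h)).
      move=> x y [_ [xab nx]] [_ [yab ny]] xy.
      have := far_lip h x y h0 xab yab nx; have := far_lip h y x h0 yab xab ny.
      rewrite (distrC x) (@ger0_norm _ (y - x)) ?subr_ge0//.
      by set w := 2 * B / h * _; rewrite ler_norml; lra.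
    apply/eqP; rewrite eq_le outer_measure_ge0 andbT -N0.
    exact: le_outer_measure.
  rewrite add0e; apply: le_trans (outer_measureU2 lam _ _) _.
  have -> : e%:E = ((e / 2)%:E + (e / 2)%:E)%E by rewrite -EFinD; congr EFin; field.
  apply: leeD; apply: lam_diam; first by lra.
  + move=> _ _ [x /=] + <- [y /=] + <-; rewrite !in_itv /= => /andP[x1 x2] /andP[y1 y2].
    have := hd1 x ltac:(lra) ltac:(rewrite ler_norml; lra).
    have := hd1 y ltac:(lra) ltac:(rewrite ler_norml; lra).
    by rewrite !ler_norml; lra.
  + by lra.
  + move=> _ _ [x /=] + <- [y /=] + <-; rewrite !in_itv /= => /andP[x1 x2] /andP[y1 y2].
    have := hd2 x ltac:(lra) ltac:(rewrite ler_norml; lra).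
    have := hd2 y ltac:(lra) ltac:(rewrite ler_norml; lra).
    by rewrite !ler_norml; lra.
Qed.


(** The functions [V - g] and [V + g] are known to be nondecreasing on samples only, whereas the
    ends of cells are arbitrary points. *)
Lemma monotone_extension (p q : R) (f : R -> R) : G p -> G q ->
  (forall s t, G s -> G t -> p <= s -> s <= t -> t <= q -> f s <= f t) ->
  exists X : R -> R, (forall x y, p <= x -> x <= y -> y <= q -> X x <= X y) /\
    (forall s, G s -> p <= s -> s <= q -> X s = f s).
Proof.
move=> Gp Gq fnd; pose S x := [set f s | s in [set s | [/\ G s, p <= s & s <= x]]].
have S0 x : p <= x -> S x !=set0 by move=> px; exists (f p), p.
have Sub x : x <= q -> ubound (S x) (f q).
  move=> xq _ [s [Gs ps sx] <-]; apply: fnd => //; exact: le_trans xq.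
exists (fun x => sup (S x)); split=> [x y px xy yq|s Gs ps sq].
  apply: ge_sup; first exact: S0.
  move=> _ [s [Gs ps sx] <-]; apply: ub_le_sup; first by exists (f q); exact: Sub.
  by exists s => //; split => //; exact: le_trans xy.
apply/eqP; rewrite eq_le; apply/andP; split.
  apply: ge_sup; first exact: S0.
  by move=> _ [t [Gt pt ts] <-]; exact: fnd.
by apply: ub_le_sup; [exists (f q); exact: Sub|exists s].
Qed.

(** If [g p <= g q], any decrease of [g] in between is bounded by the increase of [V - g], whose
    increment over [[p, q]] is exactly the excess: [g] is almost increasing, with local errors that
    add up to the excess. Otherwise [V + g] plays this role and [g] is almost decreasing. *)
Lemma lam_image_excess (N : set R) (p q : R) : lam N = 0%E ->
  G p -> G q -> p < q ->
  (lam (u @` (N `&` `[p, q]%classic)) <= (15 * (V q - V p - `|g q - g p|))%:E)%E.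
Proof.
move=> N0 Gp Gq pq; have /andP[ap _] := Gab p Gp; have /andP[_ qb] := Gab q Gq.
have pp := lexx p; have qq := lexx q; have pq' := ltW pq.
have gV' s t : G s -> G t -> s <= t -> `|g t - g s| <= V t - V s.
  move=> Gs Gt; rewrite le_eqVlt => /predU1P[->|]; last exact: gV.
  by rewrite !subrr normr0.
have [gpq|gqp] := leP (g p) (g q).
  have [|X [Xnd XE]] := monotone_extension p q (fun s => V s - g s) Gp Gq.
    by move=> s t Gs Gt _ st _; have := gV' s t Gs Gt st; rewrite ler_norml; lra.
  have -> : V q - V p - `|g q - g p| = X q - X p.
    by rewrite !XE// ger0_norm ?subr_ge0//; ring.
  apply: lam_image_gap => //; [exact: ltW|exact: ltW|].
  move=> c h x y h0 pch chq cx cy nx ny.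
  apply: (near_incr c h) => //; [lra|lra| |].
    by rewrite subr_ge0; apply: Xnd; lra.
  move=> s t Gs Gt cs st tc; have := gV s t Gs Gt st; rewrite ler_norml => /andP[k1 k2].
  have := Xnd (c - 2 * h) s pch ltac:(lra) ltac:(lra).
  have := Xnd t (c + 3 * h) ltac:(lra) ltac:(lra) chq.
  rewrite (XE s)// ?(XE t)//; lra.
have [|X [Xnd XE]] := monotone_extension p q (fun s => V s + g s) Gp Gq.
  by move=> s t Gs Gt _ st _; have := gV' s t Gs Gt st; rewrite ler_norml; lra.
have -> : V q - V p - `|g q - g p| = X q - X p.
  by rewrite !XE// ltr0_norm ?subr_lt0//; ring.
apply: lam_image_gap => //; [exact: ltW|exact: ltW|].
move=> c h x y h0 pch chq cx cy nx ny.
apply: (near_decr c h) => //; [lra|lra| |].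
  by rewrite subr_ge0; apply: Xnd; lra.
move=> s t Gs Gt cs st tc; have := gV s t Gs Gt st; rewrite ler_norml => /andP[k1 k2].
have := Xnd (c - 2 * h) s pch ltac:(lra) ltac:(lra).
have := Xnd t (c + 3 * h) ltac:(lra) ltac:(lra) chq.
rewrite (XE s)// ?(XE t)//; lra.
Qed.

Lemma lam_image_excess_list (N : set R) (p : R) (s : seq R) : lam N = 0%E ->
  G p -> (forall y, y \in s -> G y) -> path <%R p s ->
  [/\ G (last p s), p <= last p s &
   (lam (u @` (N `&` `[p, last p s]%classic)) <=
     (15 * (V (last p s) - V p - list_variation g p s))%:E)%E].
Proof.
move=> N0; elim: s p => [|q s ih] p Gp Gs /= => [_|/andP[pq qs]].
  split => //; rewrite !subrr mulr0.
  have -> : lam (u @` (N `&` `[p, p]%classic)) = 0%E; last exact: lexx.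
  apply/eqP; rewrite eq_le outer_measure_ge0 andbT.
  apply: lam_diam => // _ _ [x [_ /=]] + <- [y [_ /=]] + <-.
  by rewrite !in_itv /= -!eq_le => /eqP <- /eqP <-; rewrite subrr.
have Gq : G q by apply: Gs; rewrite mem_head.
have [Gl ql hl] := ih q Gq (fun y ys => Gs y (mem_behead (s := q :: s) ys)) qs.
split => //; first exact: le_trans (ltW pq) ql.
have h1 := lam_image_excess N p q N0 Gp Gq pq.
have sub : u @` (N `&` `[p, last q s]) `<=`
    (u @` (N `&` `[p, q])) `|` (u @` (N `&` `[q, last q s])).
  move=> _ [x [Nx /=]] + <-; rewrite in_itv /= => /andP[px xl].
  have [xq|qx] := leP x q; [left|right]; exists x => //; split => //=;
    by rewrite in_itv /= ?px ?xq ?xl ?(ltW qx).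
apply: le_trans (le_outer_measure lam _ _ sub) _.
apply: le_trans (outer_measureU2 lam _ _) _.
apply: le_trans (leeD h1 hl) _.
by rewrite -EFinD lee_fin; lra.
Qed.

Hypothesis V_nd : forall x y, x <= y -> V x <= V y.
Hypothesis V_opt : forall e, 0 < e -> exists p s, [/\ G p, path <%R p s,
  (forall y, y \in s -> G y) & K - e <= list_variation g p s].

(** Before the first and after the last point of a nearly optimal list, [V] itself serves as error
    function. The three bounds add up to 15 times [V b - V a] minus the variation along the list,
    which is at most [e / 45] because [V] takes values in [[0, K]]. *)
Lemma lam_image_max_slope (N : set R) : lam N = 0%E ->
  lam (u @` (N `&` `[a, b]%classic)) = 0%E.
Proof.
move=> N0; apply/eqP; rewrite eq_le outer_measure_ge0 andbT.
apply/lee_addgt0Pr => e e0; rewrite add0e; have e45 : 0 < e / 45 by lra.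
have [p [s [Gp ps Gs hs]]] := V_opt (e / 45) e45.
have [Gl pl hl] := lam_image_excess_list N p s N0 Gp Gs ps.
set q := last p s in Gl pl hl *.
have /andP[ap pb] := Gab p Gp; have /andP[aq qb] := Gab q Gl.
have hV s' t' : a <= s' -> s' < t' -> t' <= b ->
    (lam (u @` (N `&` `[s', t']%classic)) <= (15 * (V t' - V s'))%:E)%E.
  move=> as' st' tb'; apply: lam_image_gap => //.
    by move=> x y _ xy _; exact: V_nd.
  move=> c h x y h0 pch chq cx cy nx ny.
  apply: (near_incr c h) => //; [lra|lra| |].
    by rewrite subr_ge0; apply: V_nd; lra.
  move=> k t Gk Gt ck kt tc; have := gV k t Gk Gt kt; rewrite ler_norml => /andP[k1 k2].
  have := V_nd (c - 2 * h) k ltac:(lra).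
  have := V_nd t (c + 3 * h) ltac:(lra).
  lra.
have h1 := hV a p (lexx _) ap (ltW pb).
have h2 := hV q b (ltW aq) qb (lexx _).
have sub : u @` (N `&` `[a, b]) `<=` (u @` (N `&` `[a, p])) `|`
    ((u @` (N `&` `[p, q])) `|` (u @` (N `&` `[q, b]))).
  move=> _ [x [Nx /=]] + <-; rewrite in_itv /= => /andP[ax xb].
  have [xp|px] := leP x p.
    by left; exists x => //; split => //=; rewrite in_itv /= ax.
  right; have [xq|qx] := leP x q; [left|right]; exists x => //; split => //=;
    by rewrite in_itv /= ?xq ?xb ?(ltW px) ?(ltW qx).
apply: le_trans (le_outer_measure lam _ _ sub) _.
apply: le_trans (outer_measureU2 lam _ _) _.
apply: le_trans (leeD h1 (le_trans (outer_measureU2 lam _ _) (leeD hl h2))) _.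
rewrite -!EFinD lee_fin; have := V_bnd a; have := V_bnd p; have := V_bnd q.
by have := V_bnd b; lra.
Qed.

End MaxSlope.

(** * Stieltjes measures and densities *)

Lemma mk_cumulative (R : realType) (f : R -> R) : {homo f : x y / x <= y} ->
  continuous f -> exists w : cumulative R R, w = f :> (R -> R).
Proof.
move=> fnd fc.
by exists (HB.pack_for (cumulative R R) f (isCumulative.Build R _ R f fnd (right_continuousW fc))).
Qed.
Lemma stieltjes_itv (R : realType) (w : cumulative R R) (x y : R) : x <= y ->
  lebesgue_stieltjes_measure w `]x, y]%classic = (w y - w x)%:E.
Proof.
move=> xy; rewrite /lebesgue_stieltjes_measure /measure_extension/= measurable_mu_extE/=; last first.
  exact: is_ocitv.
by rewrite wlength_itv_bnd.
Qed.
Lemma stieltjes_le (R : realType) (w v : cumulative R R) (A : set R) :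
  (forall x y, x <= y -> w y - w x <= v y - v x) ->
  (lebesgue_stieltjes_measure w A <= lebesgue_stieltjes_measure v A)%E.
Proof.
move=> wv; apply: le_ereal_inf_tmp => _ [F [mF AF] <-].
apply: (@le_trans _ _ (\sum_(k <oo) wlength w (F k))%E).
  by apply: ereal_inf_lbound; exists F.
apply: lee_nneseries => [k _ _|k _]; first exact: wlength_ge0.
have /ocitvP[->|[[p q] /= pq Fk]] := mF k; first by rewrite !wlength0.
by rewrite Fk !wlength_itv_bnd ?(ltW pq)// lee_fin wv// ltW.
Qed.

Definition cont_on (R : realType) (a b : R) (f : R -> R) := forall x e,
  a <= x <= b -> 0 < e -> exists2 d, 0 < d &
  forall y, a <= y <= b -> `|y - x| <= d -> `|f y - f x| <= e.

Lemma cont_onP (R : realType) (a b : R) (f : R -> R) :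
  cont_on R a b f <-> {within `[a, b], continuous f}.
Proof.
split=> [fc|/subspace_continuousP fc x e xab e0].
  apply/subspace_continuousP => x; rewrite /= in_itv /= => xab.
  apply/cvgrPdist_le => e e0; have [d d0 hd] := fc x e xab e0.
  rewrite near_withinE; exists d => //= y yd; rewrite in_itv /= => yab.
  by rewrite distrC; apply: hd => //; rewrite distrC ltW.
have xab' : `[a, b]%classic x by rewrite /= in_itv.
have /cvgrPdist_le/(_ e e0) := fc x xab'; rewrite near_withinE => -[d /= d0 hd].
exists (d / 2); first by rewrite divr_gt0.
move=> y yab yx; rewrite distrC; apply: hd; rewrite /= ?in_itv//=.
by rewrite distrC (le_lt_trans yx)// ltr_pdivrMr// ltr_pMr// ltr1n.
Qed.

(** Composition with this retraction extends a function from [[a, b]] by constants, and so makes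
    monotonicity and continuity on [[a, b]] global, as a cumulative function requires. *)
Definition clamp (R : realType) (a b x : R) : R := Num.max a (Num.min b x).

Section Clamp.
Context {R : realType} (a b : R).
Hypothesis ab : a <= b.
Local Notation cl := (clamp R a b).

Lemma clamp_itv x : a <= cl x <= b.
Proof. by rewrite /clamp le_max lexx /= ge_max ab ge_min lexx. Qed.

Lemma clamp_id x : a <= x <= b -> cl x = x.
Proof. by move=> /andP[ax xb]; rewrite /clamp min_r// max_r. Qed.

Lemma clamp_nd x y : x <= y -> cl x <= cl y.
Proof.
move=> xy; rewrite /clamp ge_max le_max lexx /= le_max le_min !ge_min.
by rewrite lexx xy !orbT.
Qed.

Lemma clamp_dist x y : `|cl y - cl x| <= `|y - x|.
Proof.
suff main s t : s <= t -> cl t - cl s <= t - s.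
  have [xy|/ltW yx] := leP x y; [|rewrite distrC (distrC y)];
    by rewrite ger0_norm ?subr_ge0 ?clamp_nd// ger0_norm ?subr_ge0//; exact: main.
move=> st; rewrite /clamp /Num.max /Num.min.
by do 4 case: ifPn; rewrite -?leNgt; move: ab; lra.
Qed.

Lemma continuous_clamp (f : R -> R) : cont_on R a b f -> continuous (f \o cl).
Proof.
move=> fc x; apply/cvgrPdist_le => e e0; have [d d0 hd] := fc (cl x) e (clamp_itv x) e0.
exists d => //= y xy; rewrite distrC; apply: hd; first exact: clamp_itv.
by apply: le_trans (clamp_dist _ _) _; rewrite distrC ltW.
Qed.

End Clamp.

(** Radon-Nikodym for the restriction of the Stieltjes measure to []a, b]], which is finite; the
    hypothesis is its absolute continuity. *)
Lemma stieltjes_density (R : realType) (w : cumulative R R) (a b : R) : a < b ->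
  (forall N : set (measurableTypeR R), measurable N -> lebesgue_measure N = 0%E ->
     lebesgue_stieltjes_measure w (N `&` `]a, b]%classic) = 0%E) ->
  exists h : R -> R, [/\ forall x, 0 <= h x,
    (@lebesgue_measure R).-integrable setT (EFin \o h) &
    forall x y, a <= x -> x <= y -> y <= b ->
      (w y - w x)%:E = (\int[@lebesgue_measure R]_(t in `]x, y]) (h t)%:E)%E].
Proof.
move=> ab wN; pose E : set (measurableTypeR R) := `]a, b]%classic.
have mE : measurable E by exact: measurable_itv.
have Eoo : (lebesgue_stieltjes_measure w E < +oo)%E.
  by rewrite stieltjes_itv ?ltry// ltW.
pose nu : {finite_measure set (measurableTypeR R) -> \bar R} := mfrestr mE Eoo.
have numu : nu `<< (@lebesgue_measure R).
  apply/null_content_dominatesP => A mA A0; exact: wN.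
have [f [f0 ffin fint fE]] := radon_nikodym_sigma_finite numu.
exists (fine \o f).
have fK : EFin \o (fine \o f) = f by apply/funext => x /=; rewrite fineK.
split.
- by move=> x; exact: fine_ge0.
- by rewrite fK.
- move=> x y ax xy yb; rewrite -stieltjes_itv//.
  under eq_integral do rewrite fineK//.
  rewrite -fE; last exact: measurable_itv.
  rewrite /nu /= /mfrestr /mrestr; congr lebesgue_stieltjes_measure.
  apply/esym/setIidl => t; rewrite /E /= !in_itv /= => /andP[xt ty].
  by rewrite (le_lt_trans ax)//= (le_trans ty).
Qed.

Lemma variation_le_increment (R : realType) (a b : R) (u m : R -> R) s :
  (forall x y, a <= x -> x <= y -> y <= b -> `|u y - u x| <= m y - m x) ->
  itv_partition a b s -> variation a b u s <= m b - m a.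
Proof.
move=> um abs.
have mnd : {in `[a, b] &, nondecreasing_fun m}.
  move=> x y; rewrite !in_itv /= => /andP[ax _] /andP[_ yb] xy.
  by rewrite -subr_ge0; apply: le_trans (um x y ax xy yb).
rewrite -(nondecreasing_variation mnd abs) /variation !big_nat.
apply: ler_sum => k /andP[_ ks] /=; apply: le_trans (ler_norm _); apply: um.
- exact: itv_partition_nth_ge (ltnW _) abs.
- by apply: (nondecreasing_fun_itv_partition (f := id) _ abs) => // x y.
- exact: (itv_partition_nth_le (m := k.+1) _ abs).
Qed.

(* A set carrying [TV u] outside a null set [N] carries all of it, because [u]
   maps [N] to a null set and the variation measure dominates the measure of
   images. *)
Lemma stieltjes_total_variation_null (R : realType) (a b : R) (u : R -> R)
    (v : cumulative R R) (N : set (measurableTypeR R)) : a < b ->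
  cont_on R a b u ->
  (forall x y, a <= x -> x <= y -> y <= b -> `|u y - u x| <= v y - v x) ->
  (total_variation a b u = (v b - v a)%:E) ->
  measurable N ->
  lam (u @` (N `&` `[a, b]%classic)) = 0%E ->
  lebesgue_stieltjes_measure v (N `&` `]a, b]%classic) = 0%E.
Proof.
move=> ab uc uv TVE mN N0.
pose nu : {measure set (measurableTypeR R) -> \bar R} := lebesgue_stieltjes_measure v.
rewrite -[LHS]/(nu _).
have nuI x y : x <= y -> nu `]x, y]%classic = (v y - v x)%:E.
  exact: stieltjes_itv.
have mI (x y : R) : measurable (`]x, y]%classic : set (measurableTypeR R)).
  exact: measurable_itv.
have nufin (x y : R) (A : set (measurableTypeR R)) : measurable A ->
    nu (A `&` `]x, y]%classic) \is a fin_num.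
  move=> mA; rewrite ge0_fin_numE; last exact: measure_ge0.
  apply: (@le_lt_trans _ _ (nu `]x, Num.max x y]%classic)).
    apply: le_measure; rewrite ?inE; [exact: measurableI|exact: mI|].
    by move=> t [_ /=]; rewrite !in_itv /= => /andP[-> ty]; rewrite le_max ty orbT.
  by rewrite nuI ?le_max ?lexx// ltry.
(* Distribution function of the part of [nu] outside [N]. Once it dominates the increments of [u],
   its total mass is at least the total variation, that is all of [nu], and nothing finite remains
   for [N]. *)
pose m x := fine (nu (~` N `&` `]a, x]%classic)).
have mN' : measurable (~` N) by exact: measurableC.
have mE x y : a <= x -> x <= y ->
    nu (~` N `&` `]x, y]%classic) = (m y - m x)%:E.
  move=> ax xy; rewrite EFinB !fineK ?nufin//.
  have -> : ~` N `&` `]a, y] = (~` N `&` `]a, x]) `|` (~` N `&` `]x, y]).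
    rewrite -setIUr; congr (_ `&` _); apply/seteqP; split => t /=; rewrite !in_itv /=.
      by move=> /andP[-> ->]; have [tx|xt] := leP t x; [left|right].
    by case=> /andP[h1 h2]; rewrite ?h1 ?h2 ?(le_trans h2 xy) ?(le_lt_trans ax h1).
  rewrite measureU; [|exact: measurableI|exact: measurableI|].
    by rewrite addeAC subee ?nufin// add0e.
  apply/seteqP; split => // t [[_ /=] + [_ /=]]; rewrite !in_itv /=.
  by move=> /andP[_ tx] /andP[xt _]; move: (lt_le_trans xt tx); rewrite ltxx.
have um x y : a <= x -> x <= y -> y <= b -> `|u y - u x| <= m y - m x.
  move=> ax xy yb.
  have uc' : {within `[x, y], continuous u}.
    apply: (@continuous_subspaceW _ _ _ `[a, b]); last exact/cont_onP.
    by apply: subset_itvScc; rewrite bnd_simp.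
  rewrite -lee_fin -mE//; apply: le_trans (lam_image_itv u x y xy uc') _.
  (* The interval is closed but [nu] is known on half-open ones: the left end contributes a single
     value, the points of [N] a null image, and the other points at most their [nu]-mass. *)
  have sub : u @` `[x, y] `<=` ([set u x] `|` (u @` (N `&` `[a, b]))) `|`
      (u @` (~` N `&` `]x, y])).
    move=> _ [t /=] + <-; rewrite in_itv /= => /andP[xt ty].
    have [tx|tx] := eqVneq t x; first by left; left; rewrite tx.
    have [Nt|Nt] := pselect (N t).
      left; right; exists t => //; split => //=.
      by rewrite in_itv /= (le_trans ax)//= (le_trans ty).
    by right; exists t => //; split => //=; rewrite in_itv /= lt_neqAle eq_sym tx xt.
  apply: le_trans (le_outer_measure lam _ _ sub) _.
  apply: le_trans (outer_measureU2 lam _ _) _.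
  rewrite -[leRHS]add0e; apply: leeD.
    apply: le_trans (outer_measureU2 lam _ _) _; rewrite N0 adde0.
    by apply: lam_diam => // _ _ -> ->; rewrite subrr.
  rewrite -[leRHS]mul1e; apply: lam_image_le => // s t [_ /=] + [_ /=].
  rewrite !in_itv /= => /andP[xs sy] /andP[xt ty] st; rewrite mul1r; apply: uv => //.
    by rewrite (le_trans ax)// ltW.
  exact: le_trans yb.
have TVm : (total_variation a b u <= (m b - m a)%:E)%E.
  apply: ge_ereal_sup => _ [_ [s abs <-] <-]; rewrite lee_fin.
  exact: variation_le_increment.
have split_nu : nu `]a, b]%classic =
    (nu (N `&` `]a, b]%classic) + nu (~` N `&` `]a, b]%classic))%E.
  rewrite -measureU; [|exact: measurableI|exact: measurableI|].
    by rewrite -setIUl setUv setTI.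
  by apply/seteqP; split => // t [[h _] [h' _]].
move: TVm; rewrite TVE -(nuI _ _ (ltW ab)) split_nu.
rewrite -mE ?lexx ?(ltW ab)//.
rewrite -{2}[nu (~` N `&` _)]add0e leeD2rE ?nufin// => h.
by apply/eqP; rewrite eq_le h measure_ge0.
Qed.

(** Jordan decomposition: half the sum and half the difference of the variation function and [u] are
    nondecreasing, with increments below those of the variation function, so they inherit its
    absolute continuity. Their densities satisfy [|h1 - h2| <= h1 + h2], and the right side
    integrates to the total variation. *)
Lemma density_of_luzin (R : realType) (a b : R) (u : R -> R) : a < b ->
  cont_on R a b u -> bounded_variation a b u ->
  (forall N : set R, lebesgue_measure N = 0%E ->
     lam (u @` (N `&` `[a, b]%classic)) = 0%E) ->
  exists h : R -> R, [/\ (@lebesgue_measure R).-integrable setT (EFin \o h),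
    forall x, a <= x <= b -> ((u x - u a)%:E =
       \int[@lebesgue_measure R]_(t in `]a, x]) (h t)%:E)%E &
    (\int[@lebesgue_measure R]_(t in `]a, b]) `|(h t)%:E| <= total_variation a b u)%E].
Proof.
move=> ab uc bv uN; pose tv := fine \o total_variation a ^~ u.
have tvfin x : a <= x <= b -> total_variation a x u \is a fin_num.
  by move=> /andP[ax xb]; apply/bounded_variationP => //; exact: bounded_variationl bv.
have tvE x : a <= x <= b -> total_variation a x u = (tv x)%:E.
  by move=> xab; rewrite /tv /= fineK ?tvfin.
have tvc : cont_on R a b tv.
  by apply/cont_onP; apply: total_variation_continuous => //; exact/cont_onP.
have tvu x y : a <= x -> x <= y -> y <= b -> `|u y - u x| <= tv y - tv x.
  move=> ax xy yb; have ay := le_trans ax xy; have xb := le_trans xy yb.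
  rewrite -lee_fin EFinB -!tvE ?ax ?ay//.
  rewrite (total_variationD u ax xy) addeAC subee ?tvfin ?ax// add0e.
  exact: total_variation_ge.
have tv0 : tv a = 0 by rewrite /tv /= total_variationxx.
have clu x y : x <= y -> `|u (clamp R a b y) - u (clamp R a b x)| <=
    tv (clamp R a b y) - tv (clamp R a b x).
  move=> xy; have /andP[h1 _] := clamp_itv a b (ltW ab) x.
  have /andP[_ h2] := clamp_itv a b (ltW ab) y.
  by apply: tvu => //; exact: clamp_nd.
have ctv := continuous_clamp a b (ltW ab) tv tvc.
have cu := continuous_clamp a b (ltW ab) u uc.
have [v vE] : exists v : cumulative R R, v = tv \o clamp R a b :> (R -> R).
  apply: mk_cumulative => // x y xy /=.
  by rewrite -subr_ge0; apply: le_trans (clu x y xy).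
have [v1 v1E] : exists v : cumulative R R,
    v = (fun x => (tv (clamp R a b x) + u (clamp R a b x)) / 2) :> (R -> R).
  apply: mk_cumulative => [x y xy|x].
    by have := clu x y xy; rewrite ler_norml; lra.
  by apply: cvgMl; apply: cvgD; [exact: ctv|exact: cu].
have [v2 v2E] : exists v : cumulative R R,
    v = (fun x => (tv (clamp R a b x) - u (clamp R a b x)) / 2) :> (R -> R).
  apply: mk_cumulative => [x y xy|x].
    by have := clu x y xy; rewrite ler_norml; lra.
  by apply: cvgMl; apply: cvgB; [exact: ctv|exact: cu].
have vN (N : set (measurableTypeR R)) : measurable N -> lebesgue_measure N = 0%E ->
    lebesgue_stieltjes_measure v (N `&` `]a, b]%classic) = 0%E.
  move=> mN N0; apply: (stieltjes_total_variation_null R a b u) => //.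
  - move=> x y ax xy yb; rewrite vE /= !clamp_id ?ax ?(le_trans ax)//.
      exact: tvu.
    exact: le_trans yb.
  - by rewrite vE /= !clamp_id ?lexx ?(ltW ab)// tv0 subr0 tvE// lexx ltW.
  - exact: uN.
have viN (w : cumulative R R) : (forall x y, x <= y -> w y - w x <= v y - v x) ->
    forall N : set (measurableTypeR R), measurable N -> lebesgue_measure N = 0%E ->
    lebesgue_stieltjes_measure w (N `&` `]a, b]%classic) = 0%E.
  move=> wv N mN N0; apply/eqP; rewrite eq_le; apply/andP; split; last first.
    exact: measure_ge0.
  by rewrite -(vN N mN N0); exact: stieltjes_le.
have v1v x y : x <= y -> v1 y - v1 x <= v y - v x.
  by move=> xy; rewrite vE v1E /=; have := clu x y xy; rewrite ler_norml; lra.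
have v2v x y : x <= y -> v2 y - v2 x <= v y - v x.
  by move=> xy; rewrite vE v2E /=; have := clu x y xy; rewrite ler_norml; lra.
have [h1 [h10 h1i h1E]] := stieltjes_density R v1 a b ab (viN v1 v1v).
have [h2 [h20 h2i h2E]] := stieltjes_density R v2 a b ab (viN v2 v2v).
have mI (x y : R) : measurable (`]x, y]%classic : set (measurableTypeR R)).
  exact: measurable_itv.
have h1i' x y : (@lebesgue_measure R).-integrable `]x, y]%classic (EFin \o h1).
  by apply: integrableS h1i.
have h2i' x y : (@lebesgue_measure R).-integrable `]x, y]%classic (EFin \o h2).
  by apply: integrableS h2i.
exists (fun x => h1 x - h2 x); split.
- have -> : EFin \o (fun x => h1 x - h2 x) = ((EFin \o h1) \- (EFin \o h2))%E by [].
  exact: integrableB.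
- move=> x /andP[ax xb].
  under eq_integral do rewrite EFinB.
  rewrite integralB//= -h1E ?lexx// -h2E ?lexx// -EFinB; congr EFin.
  by rewrite v1E v2E /= !clamp_id ?lexx ?ax ?(ltW ab)//; field.
- apply: (@le_trans _ _ (\int[@lebesgue_measure R]_(t in `]a, b]) ((h1 t)%:E + (h2 t)%:E))%E).
    apply: ge0_le_integral => //.
    + rewrite (_ : (fun t => _) = EFin \o (fun t => `|h1 t - h2 t|))//.
      apply/measurable_EFinP.
      apply: measurableT_comp => //; apply: measurable_funB; apply/measurable_EFinP.
        exact: (measurable_int (@lebesgue_measure R) (h1i' a b)).
      exact: (measurable_int (@lebesgue_measure R) (h2i' a b)).
    + apply: emeasurable_funD; first exact: (measurable_int (@lebesgue_measure R) (h1i' a b)).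
      exact: (measurable_int (@lebesgue_measure R) (h2i' a b)).
    + move=> t _; rewrite -EFinD lee_fin.
      by rewrite (le_trans (ler_normB _ _))// !ger0_norm.
  rewrite integralD//= -h1E ?lexx ?(ltW ab)// -h2E ?lexx ?(ltW ab)// -EFinD.
  rewrite tvE ?lexx ?(ltW ab)// lee_fin.
  by rewrite v1E v2E /= !clamp_id ?lexx ?(ltW ab)// tv0; lra.
Qed.

(** * Test functions and integration by parts *)

Section TestFunctions.
Context {R : realType} (a b : R) (phi : R -> R).
Hypothesis ab : a < b.
Hypothesis tphi : test_function `]a, b[%classic phi.

Lemma test_function_derivable n x : derivable (derive1n n phi) x 1.
Proof. exact: tphi.1. Qed.

Lemma test_function_continuous : continuous phi.
Proof.
by move=> x; apply/differentiable_continuous/derivable1_diffP; exact: (test_function_derivable 0).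
Qed.

Lemma test_function_derive_continuous : continuous (derive1 phi).
Proof.
by move=> x; apply/differentiable_continuous/derivable1_diffP; exact: (test_function_derivable 1).
Qed.

Lemma test_function_outside x : ~ (a < x < b) -> phi x = 0.
Proof.
have [K [_ Kab K0]] := tphi.2.
by move=> nx; apply: K0 => /Kab /=; rewrite in_itv.
Qed.

Lemma test_function_derive_outside x : ~ (a < x < b) -> derive1 phi x = 0.
Proof.
have [K [cK Kab K0]] := tphi.2.
move=> nx; have Kx : (~` K) x by move=> /Kab /=; rewrite in_itv.
have oK : open (~` K) by apply: closed_openC; apply: compact_closed => //.
rewrite derive1E -(@near_eq_derive _ _ _ (cst 0)); first by rewrite derive_cst.
have : nbhs x (~` K) by exact: open_nbhs_nbhs.
by apply: filterS => y Ky /=; rewrite K0.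
Qed.

Lemma vanishing_bounded (f : R -> R) : continuous f ->
  (forall x, ~ (a < x < b) -> f x = 0) -> exists2 C, 0 <= C & forall x, `|f x| <= C.
Proof.
move=> fc f0; have cf : {within `[a, b], continuous (fun x => `|f x|)}.
  apply: continuous_subspaceT => x; apply: cvg_norm; exact: fc.
have [c cab hc] := EVT_max (ltW ab) cf.
exists `|f c| => // x; have [xab|xab] := pselect (a < x < b).
  by apply: hc; rewrite in_itv /=; move: xab => /andP[/ltW -> /ltW ->].
by rewrite f0// normr0.
Qed.

Lemma vanishing_integrable (f : R -> R) (D : set (measurableTypeR R)) : continuous f ->
  (forall x, ~ (a < x < b) -> f x = 0) -> measurable D ->
  (@lebesgue_measure R).-integrable D (EFin \o f).
Proof.
move=> fc f0 mD; apply: (integrableS measurableT) => //.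
have -> : EFin \o f = (EFin \o f) \_ `[a, b].
  apply/funext => x; rewrite patchE; case: ifPn => // /negP xab /=.
  rewrite f0// => /andP[ax xb]; apply: xab; rewrite inE /= in_itv /=.
  by rewrite !ltW.
apply/(integrable_mkcond _ _).1; first exact: measurable_itv.
apply: continuous_compact_integrable; first exact: segment_compact.
exact: continuous_subspaceT.
Qed.

Lemma test_function_FTC y : y < b ->
  (\int[@lebesgue_measure R]_(x in `[y, b]) (derive1 phi x)%:E = (- phi y)%:E)%E.
Proof.
move=> yb; rewrite (@continuous_FTC2 _ _ phi)//.
- by rewrite (@test_function_outside b) ?sub0e ?ltxx ?andbF.
- exact/continuous_subspaceT/test_function_derive_continuous.
- split; first by move=> x _; exact: (test_function_derivable 0).
    by apply: cvg_at_right_filter; exact: test_function_continuous.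
  by apply: cvg_at_left_filter; exact: test_function_continuous.
Qed.

(** Fubini for [h y * phi' x] on the triangle [y <= x]: integrating in [y] first gives
    [(u x - u a) * phi' x], and integrating in [x] first gives [- h y * phi y], since [phi] vanishes
    at [b]. *)
Lemma weak_derive_density (u h : R -> R) :
  (@lebesgue_measure R).-integrable setT (EFin \o h) ->
  (forall x, a <= x <= b -> ((u x - u a)%:E =
       \int[@lebesgue_measure R]_(t in `]a, x]) (h t)%:E)%E) ->
  (\int[@lebesgue_measure R]_(x in `]a, b[) ((u x - u a) * derive1 phi x)%:E =
   - \int[@lebesgue_measure R]_(x in `]a, b[) (h x * phi x)%:E)%E.
Proof.
move=> hi uE; pose mu := @lebesgue_measure R.
pose D : set (measurableTypeR R) := `]a, b[%classic.
have mD : measurable D by exact: measurable_itv.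
pose k := h \_ D.
have mh : measurable_fun setT h.
  by apply/measurable_EFinP; exact: measurable_int hi.
have ki : mu.-integrable setT (EFin \o k).
  have -> : EFin \o k = (EFin \o h) \_ D by rewrite restrict_EFin.
  by apply/(integrable_mkcond _ _).1 => //; exact: integrableS hi.
have mk : measurable_fun setT k.
  by apply/measurable_EFinP; exact: measurable_int ki.
have mphi' : measurable_fun setT (derive1 phi).
  exact: continuous_measurable_fun test_function_derive_continuous.
have phi'i : mu.-integrable setT (EFin \o derive1 phi).
  apply: vanishing_integrable => //; first exact: test_function_derive_continuous.
  exact: test_function_derive_outside.
pose S : set (measurableTypeR R * measurableTypeR R) := [set p | p.2 <= p.1].
have mS : measurable S.
  rewrite -[S]setTI (_ : _ `&` _ = setT `&` (fun p => p.2 <= p.1) @^-1` [set true]).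
    by apply: (measurable_fun_ler _ _).
  by rewrite !setTI; apply/seteqP; split => p.
pose F (p : measurableTypeR R * measurableTypeR R) : \bar R :=
  (\1_S p * (k p.2 * derive1 phi p.1))%:E.
have mF : measurable_fun setT F.
  apply/measurable_EFinP; apply: measurable_funM => //.
  by apply: measurable_funM; apply: measurableT_comp.
have SE x y : ((x, y) \in S) = (y <= x) by apply/idP/idP; rewrite inE.
have IE x (i : interval R) : (x \in [set` i]) = (x \in i) by apply/idP/idP; rewrite inE.
have phi'nn : (\int[mu]_x `|(derive1 phi x)%:E| < +oo)%E by case/integrableP: phi'i.
have knn : (\int[mu]_x `|(k x)%:E| < +oo)%E by case/integrableP: ki.
have Fi : (mu \x mu)%E.-integrable setT F.
  apply/integrable12ltyP => //.
  apply: (@le_lt_trans _ _ (\int[mu]_x (`|(derive1 phi x)%:E| * \int[mu]_y `|(k y)%:E|))%E).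
    apply: ge0_le_integral => //.
    - by move=> x _; apply: integral_ge0.
    - by apply: (measurable_fun_fubini_tonelli_F (abse \o F)) => //=; exact: measurableT_comp.
    - apply: emeasurable_funM => //; apply: measurableT_comp => //.
      exact/measurable_EFinP.
    - move=> x _; rewrite -ge0_integralZl//; last first.
        by apply: measurableT_comp => //; exact/measurable_EFinP.
      apply: ge0_le_integral => //.
      + apply: (measurableT_comp (f := abse)) => //.
        by apply: (measurableT_comp mF); exact: pair1_measurable.
      + apply: emeasurable_funM => //; apply: measurableT_comp => //.
        exact/measurable_EFinP.
      + move=> y _; rewrite /F /= -EFinM lee_fin !normrM [leRHS]mulrC.
        rewrite -[leRHS]mul1r ler_wpM2r// ?mulr_ge0// indicE.
        by case: (_ \in _); rewrite ?normr0 ?normr1.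
  rewrite ge0_integralZr//; last exact: integral_ge0.
    by rewrite lte_mul_pinfty// ?integral_ge0// ge0_fin_numE// integral_ge0.
  by apply: measurableT_comp => //; exact/measurable_EFinP.
transitivity (\int[mu]_x \int[mu]_y F (x, y))%E.
  apply/esym; rewrite [RHS]integral_mkcond; apply: eq_integral => x _; rewrite patchE.
  case: ifPn => [|xD].
    rewrite inE /D /= in_itv /= => /andP[ax xb].
    rewrite EFinM uE ?ltW// -integralZr//; last first.
      by apply: (integrableS measurableT) => //; exact: measurable_itv.
    rewrite [RHS]integral_mkcond; apply: eq_integral => y _.
    rewrite /F /k /= indicE SE !patchE /D !IE !in_itv /=.
    have [ya|ay] := leP y a; first by rewrite /= mul0r mulr0.
    rewrite /=; have [yx|xy] := leP y x; last by rewrite mul0r.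
    by rewrite mul1r (le_lt_trans yx xb).
  rewrite /F /= test_function_derive_outside; last first.
    by move=> xab; move: xD; rewrite notin_setE; apply; rewrite /D /= in_itv.
  by under eq_integral do rewrite !mulr0; rewrite integral0.
have hphi : mu.-integrable D (fun x => (h x * phi x)%:E).
  have [C C0 phiC] := vanishing_bounded phi test_function_continuous test_function_outside.
  apply: (@le_integrable _ _ _ mu D mD _ (fun x => C%:E * (h x)%:E)%E).
  + apply/measurable_EFinP; apply: measurable_funM; apply: measurable_funS measurableT _ _ => //.
    exact: continuous_measurable_fun test_function_continuous.
  + move=> x _; rewrite -EFinM lee_fin normrM mulrC normrM ler_wpM2r//.
    by rewrite (le_trans (phiC x))// ler_norm.
  + by apply: integrableZl => //; exact: integrableS hi.
apply: etrans (Fubini Fi) _; rewrite -integralN; last exact: integrable_add_def hphi.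
rewrite [RHS]integral_mkcond; apply: eq_integral => y _; rewrite patchE.
case: ifPn => [|yD].
  rewrite inE /D /= in_itv /= => /andP[ay yb].
  have kE : k y = h y by rewrite /k patchE /D IE in_itv /= ay yb.
  transitivity ((h y)%:E * (- phi y)%:E)%E; last by rewrite -EFinM mulrN.
  rewrite -(test_function_FTC _ yb) -integralZl//; last first.
    by apply: (integrableS measurableT) => //; exact: measurable_itv.
  rewrite [RHS]integral_mkcond; apply: eq_integral => x _.
  rewrite /F /= kE indicE SE !patchE /D !IE !in_itv /=.
  have [yx|xy] := leP y x; last by rewrite mul0r.
  rewrite mul1r /=; case: ifPn => //; rewrite -ltNge => bx.
  by rewrite test_function_derive_outside ?mulr0// => /andP[_]; rewrite ltNge ltW.
have F0 x : F (x, y) = 0%E by rewrite /F /k /= patchE (negbTE yD) mul0r mulr0.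
by under eq_integral do rewrite F0; rewrite integral0.
Qed.
End TestFunctions.

(** * Explicit smooth functions *)

(** The powers of [1 / x] are included because the derivative of a member of this family is a
    combination of two others; one computation then yields derivatives of every order. *)
Definition flat_exp (R : realType) (n : nat) (x : R) : R :=
  if 0 < x then x^-1 ^+ n * expR (- x^-1) else 0.

Section FlatExp.
Context {R : realType}.
Local Notation psi := (flat_exp R).

Lemma flat_exp_ge0 n x : 0 <= psi n x.
Proof.
rewrite /flat_exp; case: ifPn => // x0.
by rewrite mulr_ge0 ?expR_ge0// exprn_ge0// invr_ge0 ltW.
Qed.

(** With [m = n + 1] and [y = 1 / x], raising [y / m <= expR (y / m)] to the power [m] bounds
    [y ^+ m * expR (- y)] by [m ^+ m]. *)
Lemma flat_exp_le n : exists2 C, 0 < C & forall x, 0 < x -> psi n x <= C * x.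
Proof.
pose m : R := n.+1%:R; have m0 : 0 < m by rewrite ltr0n.
exists (m ^+ n.+1) => [|x x0]; first by rewrite exprn_gt0.
rewrite /flat_exp x0; set y := x^-1.
have y0 : 0 < y by rewrite invr_gt0.
have h : y ^+ n.+1 * expR (- y) <= m ^+ n.+1.
  rewrite expRN ler_pdivrMr ?expR_gt0//.
  have -> : expR y = expR (y / m) ^+ n.+1.
    by rewrite -expRM_natl -/m mulrC mulfVK// gt_eqF.
  rewrite -exprMn lerXn2r ?nnegrE ?(ltW y0) ?mulr_ge0 ?expR_ge0 ?(ltW m0)//.
  rewrite -ler_pdivrMl// mulrC; apply: le_trans (expR_ge1Dx _).
  by rewrite lerDr.
rewrite -ler_pdivrMr// -/y mulrAC -exprSr; exact: h.
Qed.

Lemma is_derive_of_cvg (f : R -> R) (x df : R) :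
  h^-1 *: (f (h *: 1 + x) - f x) @[h --> 0^'] --> df -> is_derive x 1 f df.
Proof. by move=> h; split; [exact: (cvgP df)|exact: cvg_lim h]. Qed.

Lemma is_derive_flat_exp n (x : R) :
  is_derive x 1 (psi n) (psi n.+2 x - n%:R * psi n.+1 x).
Proof.
case: (ltgtP x 0) => [x0|x0|->].
- rewrite /flat_exp !ltNge (ltW x0) /= mulr0 subrr.
  apply: (@near_eq_is_derive _ _ _ (cst 0)).
  have : \forall y \near x, y < 0 by exact: lt_nbhsl.
  by apply: filterS => y y0; rewrite /flat_exp /= ltNge (ltW y0).
- have xn0 : x != 0 by rewrite gt_eqF.
  have hV : is_derive x 1 (fun y : R => y^-1) (- x ^- 2).
    apply: (is_derive_eq (is_deriveV (f := id) xn0 (is_derive_id x 1))).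
    by rewrite [_ *: _]mulr1.
  have hE : is_derive x 1 (fun y : R => expR (- y^-1)) (x ^- 2 * expR (- x^-1)).
    have hN := is_deriveN hV.
    apply: (is_derive_eq (is_derive1_comp (is_derive_expR _) hN)).
    by rewrite opprK mulrC.
  have hX : is_derive x 1 (fun y : R => y^-1 ^+ n) (- n%:R * x^-1 ^+ n.+1).
    have -> : (fun y : R => y^-1 ^+ n) = (fun y : R => y^-1) ^+ n.
      by apply/funext => y; rewrite exprfctE.
    apply: (is_derive_eq (is_deriveX n hV)); case: n => [|n] /=.
      by rewrite !mul0r oppr0 mul0r scale0r.
    rewrite /GRing.scale /= -!exprVn !exprS; ring.
  have hM : is_derive x 1 (fun y : R => y^-1 ^+ n * expR (- y^-1))
      (psi n.+2 x - n%:R * psi n.+1 x).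
    apply: (is_derive_eq (is_deriveM hX hE)).
    by rewrite /flat_exp x0 /GRing.scale /= -!exprVn !exprS; ring.
  apply: near_eq_is_derive hM.
  have : \forall y \near x, 0 < y by exact: lt_nbhsr.
  by apply: filterS => y y0; rewrite /flat_exp y0.
- rewrite /flat_exp ltxx mulr0 subrr; apply: is_derive_of_cvg.
  (* For [h > 0] the difference quotient at 0 is [psi n.+1 h], hence at most [C * h]. *)
  have [C C0 hC] := flat_exp_le n.+1.
  apply/cvgrPdist_le => e e0; rewrite near_withinE.
  exists (e / C) => /=; first by rewrite divr_gt0.
  move=> h /=; rewrite sub0r normrN ltr_pdivlMr// => hC' hn0.
  rewrite /flat_exp ltxx sub0r normrN subr0 addr0 [_ *: 1]mulr1.
  case: ifPn => [h0|]; last by rewrite scaler0 normr0 ltW.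
  have := hC h h0; rewrite /flat_exp h0 exprS -mulrA => hh.
  rewrite ger0_norm.
    by apply: le_trans hh _; rewrite mulrC ltW// -[h in h * C]gtr0_norm.
  rewrite /GRing.scale /= mulr_ge0 ?invr_ge0 ?(ltW h0)// mulr_ge0 ?expR_ge0//.
  by rewrite exprn_ge0// invr_ge0 ltW.
Qed.

(* An explicit class stable by derivation, which avoids proving that [derive1n]
   is compatible with sums and products at every order. *)
Inductive smooth : (R -> R) -> Prop :=
| smooth_flat n c d : smooth (fun x => psi n (c * x + d))
| smooth_cst c : smooth (fun=> c)
| smooth_add f g : smooth f -> smooth g -> smooth (fun x => f x + g x)
| smooth_mul f g : smooth f -> smooth g -> smooth (fun x => f x * g x)
| smooth_inv f : smooth f -> (forall x, f x != 0) -> smooth (fun x => (f x)^-1).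

Lemma smooth_affine f c d : smooth f -> smooth (fun x => f (c * x + d)).
Proof.
elim=> [n c' d'|c'|f' g _ hf _ hg|f' g _ hf _ hg|f' _ hf f0].
- have -> : (fun x => psi n (c' * (c * x + d) + d')) =
      (fun x => psi n ((c' * c) * x + (c' * d + d'))).
    by apply/funext => x; congr flat_exp; ring.
  exact: smooth_flat.
- exact: smooth_cst.
- exact: smooth_add.
- exact: smooth_mul.
- exact: smooth_inv.
Qed.

Lemma smooth_is_derive f : smooth f ->
  exists2 g, smooth g & forall x : R, is_derive x 1 f (g x).
Proof.
elim=> [n c d|c|f1 f2 _ [g1 s1 h1] _ [g2 s2 h2]|f1 f2 S1 [g1 s1 h1] S2 [g2 s2 h2]
  |f1 S1 [g1 s1 h1] f0].
- exists (fun x => c * (psi n.+2 (c * x + d) + (- n%:R) * psi n.+1 (c * x + d))).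
    apply: smooth_mul; first exact: smooth_cst.
    apply: smooth_add; first exact: smooth_flat.
    by apply: smooth_mul; [exact: smooth_cst|exact: smooth_flat].
  move=> x; have ha : is_derive x 1 (fun x : R => c * x + d) c.
    apply: (is_derive_eq (is_deriveD (is_deriveZ c (is_derive_id x 1))
      (is_derive_cst d x 1))).
    by rewrite addr0 [_ *: 1]mulr1.
  apply: (is_derive_eq (is_derive1_comp (g := fun x : R => c * x + d)
    (is_derive_flat_exp n (c * x + d)) ha)).
  by rewrite mulrC mulNr.
- by exists (fun=> 0); [exact: smooth_cst|move=> x; exact: is_derive_cst].
- exists (fun x => g1 x + g2 x); first exact: smooth_add.
  by move=> x; exact: (is_deriveD (h1 x) (h2 x)).
- exists (fun x => f1 x * g2 x + f2 x * g1 x).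
    by apply: smooth_add; exact: smooth_mul.
  by move=> x; exact: (is_deriveM (h1 x) (h2 x)).
- exists (fun x => (-1) * ((f1 x)^-1 * (f1 x)^-1) * g1 x).
    apply: smooth_mul => //; apply: smooth_mul; first exact: smooth_cst.
    by apply: smooth_mul; exact: smooth_inv.
  move=> x; apply: (is_derive_eq (is_deriveV (f0 x) (h1 x))).
  by rewrite /GRing.scale /= -!exprVn; ring.
Qed.

Lemma smooth_derive1 f : smooth f -> smooth (derive1 f) /\
  forall x : R, is_derive x 1 f (derive1 f x).
Proof.
move=> /smooth_is_derive[g sg fg].
have -> : derive1 f = g by apply/funext => x; rewrite derive1E; have [_] := fg x.
by [].
Qed.

Lemma smooth_derive1n f n : smooth f -> smooth (derive1n n f).
Proof. by move=> sf; elim: n => //= n /smooth_derive1[]. Qed.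

Lemma smooth_derivable f n (x : R) : smooth f -> derivable (derive1n n f) x 1.
Proof. by move=> /(smooth_derive1n f n)/smooth_derive1[_ /(_ x)[]]. Qed.

Lemma smooth_continuous f : smooth f -> continuous f.
Proof.
move=> sf x; apply/differentiable_continuous/derivable1_diffP.
exact: (smooth_derivable f 0).
Qed.

Lemma flat_exp_nd x y : x <= y -> psi 0 x <= psi 0 y.
Proof.
move=> xy; have [x0|x0] := leP x 0.
  by rewrite {1}/flat_exp ltNge x0 /= flat_exp_ge0.
have y0 := lt_le_trans x0 xy.
by rewrite /flat_exp x0 y0 !expr0 !mul1r ler_expR lerN2 lef_pV2.
Qed.

Lemma flat_exp_gt0 x : 0 < x -> 0 < psi 0 x.
Proof. by move=> x0; rewrite /flat_exp x0 expr0 mul1r expR_gt0. Qed.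

(** The usual smooth transition from 0 at -1 to 1 at 1. The arguments are written [c * x + d] to
    match the constructor [smooth_flat]. *)
Definition smooth_step (x : R) : R :=
  psi 0 (1 * x + 1) * (psi 0 (1 * x + 1) + psi 0 (-1 * x + 1))^-1.

Let den_gt0 x : 0 < psi 0 (1 * x + 1) + psi 0 (-1 * x + 1).
Proof.
have [x0|x0] := leP 0 x.
  by rewrite ltr_pwDl ?flat_exp_ge0// flat_exp_gt0//; lra.
by rewrite ltr_wpDl ?flat_exp_ge0// flat_exp_gt0//; lra.
Qed.

Lemma smooth_stepP : smooth smooth_step.
Proof.
apply: smooth_mul; first exact: smooth_flat.
apply: smooth_inv => [|x]; last by rewrite gt_eqF.
by apply: smooth_add; exact: smooth_flat.
Qed.

Lemma smooth_step_itv x : 0 <= smooth_step x <= 1.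
Proof.
rewrite /smooth_step ler_pdivrMr// [1 * (_ + _)]mul1r lerDl flat_exp_ge0 andbT.
by rewrite divr_ge0 ?flat_exp_ge0// ltW.
Qed.

Lemma smooth_step0 x : x <= -1 -> smooth_step x = 0.
Proof.
move=> x1; rewrite /smooth_step {1}/flat_exp.
by rewrite ltNge (_ : _ <= 0) ?mul0r//; lra.
Qed.

Lemma smooth_step1 x : 1 <= x -> smooth_step x = 1.
Proof.
move=> x1; rewrite /smooth_step {3}/flat_exp.
rewrite [0 < -1 * x + 1]ltNge (_ : -1 * x + 1 <= 0) ?addr0 ?divff//; last by lra.
by rewrite gt_eqF// flat_exp_gt0//; lra.
Qed.

Lemma smooth_step_nd x y : x <= y -> smooth_step x <= smooth_step y.
Proof.
move=> xy; rewrite /smooth_step ler_pdivrMr// mulrAC ler_pdivlMr//.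
have h1 : psi 0 (1 * x + 1) <= psi 0 (1 * y + 1) by apply: flat_exp_nd; lra.
have h2 : psi 0 (-1 * y + 1) <= psi 0 (-1 * x + 1) by apply: flat_exp_nd; lra.
rewrite !mulrDr [X in _ <= X + _]mulrC lerD2l.
by apply: ler_pM => //; exact: flat_exp_ge0.
Qed.

End FlatExp.

(** * Mollification at Lebesgue points *)

Section Mollify.
Context {R : realType}.
Local Notation mu := (@lebesgue_measure R).

(** The transition takes place on [[x - d, x + d]], and the derivative in [z] is a mollifying kernel
    centred at [x]. *)
Definition step_at (d x z : R) : R := smooth_step (d^-1 * z + - (d^-1 * x)).

Lemma step_at_smooth (d x : R) : smooth (step_at d x).
Proof. exact: smooth_affine smooth_stepP. Qed.

Lemma step_at_itv (d x z : R) : 0 <= step_at d x z <= 1.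
Proof. exact: smooth_step_itv. Qed.

Lemma step_at_le (d x y z : R) : 0 < d -> x <= y -> step_at d y z <= step_at d x z.
Proof.
move=> d0 xy; apply: smooth_step_nd; rewrite lerD2l lerN2 ler_pM2l//.
by rewrite invr_gt0.
Qed.

Lemma step_at_arg (d x z : R) : 0 < d -> d^-1 * z + - (d^-1 * x) = (z - x) / d.
Proof. by move=> d0; rewrite mulrC (mulrC _ x) -mulrBl. Qed.

Lemma step_at0 (d x z : R) : 0 < d -> z <= x - d -> step_at d x z = 0.
Proof.
move=> d0 zx; rewrite /step_at step_at_arg//; apply: smooth_step0.
by rewrite ler_pdivrMr//; lra.
Qed.

Lemma step_at1 (d x z : R) : 0 < d -> x + d <= z -> step_at d x z = 1.
Proof.
move=> d0 zx; rewrite /step_at step_at_arg//; apply: smooth_step1.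
by rewrite ler_pdivlMr//; lra.
Qed.

Lemma derive1_locally_cst (f : R -> R) (x c : R) :
  nbhs x [set z | f z = c] -> derive1 f x = 0.
Proof.
move=> h; rewrite derive1E -(@near_eq_derive _ _ _ (cst c)); first by rewrite derive_cst.
by apply: filterS h => z ->.
Qed.

Lemma derive1_step_at_outside (d x z : R) : 0 < d -> d < `|z - x| ->
  derive1 (step_at d x) z = 0.
Proof.
move=> d0; rewrite lter_normr => /orP[h|h].
  apply: (derive1_locally_cst (step_at d x) z 1).
  have : \forall y \near z, x + d < y by apply: lt_nbhsr; lra.
  by apply: filterS => y hy /=; rewrite step_at1// ltW.
apply: (derive1_locally_cst (step_at d x) z 0).
have : \forall y \near z, y < x - d by apply: lt_nbhsl; lra.
by apply: filterS => y hy /=; rewrite step_at0// ltW.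
Qed.

Lemma derive1_step_at_bounded : exists2 C, 0 <= C &
  forall d x z, 0 < d -> `|derive1 (step_at d x) z| <= C / d.
Proof.
have [sS hS] := smooth_derive1 (@smooth_step R) smooth_stepP.
have [|||C C0 hC] := @vanishing_bounded R (-2) 2 _ (derive1 (@smooth_step R)).
- by lra.
- exact: smooth_continuous.
- move=> x hx; have [x2|x2] := leP x (-2).
    apply: (derive1_locally_cst smooth_step x 0).
    have : \forall y \near x, y < -1 by apply: lt_nbhsl; lra.
    by apply: filterS => y hy /=; rewrite smooth_step0// ltW.
  apply: (derive1_locally_cst smooth_step x 1).
  have : \forall y \near x, 1 < y.
    by apply: lt_nbhsr; move/negP: hx; rewrite x2 /= -leNgt; lra.
  by apply: filterS => y hy /=; rewrite smooth_step1// ltW.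
exists C => // d x z d0.
have ha : is_derive z 1 (fun z : R => d^-1 * z + - (d^-1 * x)) d^-1.
  apply: (is_derive_eq (is_deriveD (is_deriveZ d^-1 (is_derive_id z 1))
    (is_derive_cst (- (d^-1 * x)) z 1))).
  by rewrite addr0 [_ *: 1]mulr1.
have := is_derive1_comp (g := fun z : R => d^-1 * z + - (d^-1 * x)) (hS _) ha.
move=> [_]; rewrite -derive1E => E.
rewrite /step_at [X in `|X|]E normrM; apply: ler_pM => //.
by rewrite gtr0_norm ?invr_gt0.
Qed.

Lemma step_at_derive_continuous (d x : R) : continuous (derive1 (step_at d x)).
Proof.
apply: smooth_continuous.
by have [] := smooth_derive1 _ (step_at_smooth d x).
Qed.

Lemma integrable_mul_bounded (F p : R -> R) (C : R) :
  mu.-integrable setT (EFin \o F) -> continuous p -> (forall z, `|p z| <= C) ->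
  mu.-integrable setT (EFin \o (fun z => F z * p z)).
Proof.
move=> Fi pc pC.
have mF : measurable_fun setT F by apply/measurable_EFinP; exact: measurable_int Fi.
apply: (@le_integrable _ _ _ mu setT measurableT _ (fun x => C%:E * (F x)%:E)%E).
- apply/measurable_EFinP; apply: measurable_funM => //.
  exact: continuous_measurable_fun.
- move=> x _; rewrite -EFinM lee_fin normrM mulrC normrM ler_wpM2r//.
  by rewrite (le_trans (pC x))// ler_norm.
- exact: integrableZl.
Qed.

Lemma step_at_derive_integrable (d x : R) : 0 < d ->
  mu.-integrable setT (EFin \o derive1 (step_at d x)).
Proof.
move=> d0; apply: (@vanishing_integrable R (x - 2 * d) (x + 2 * d)) => //.
- exact: step_at_derive_continuous.
- move=> z hz; apply: derive1_step_at_outside => //; rewrite ltNge ler_norml.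
  by apply/negP => h; apply: hz; lra.
Qed.

Lemma Rintegral_step_at_derive (d x : R) : 0 < d ->
  (\int[mu]_z derive1 (step_at d x) z)%R = 1.
Proof.
move=> d0; set r := 2 * d; rewrite /Rintegral.
have -> : (\int[mu]_z (derive1 (step_at d x) z)%:E =
    \int[mu]_(z in `[(x - r)%R, (x + r)%R]) (derive1 (step_at d x) z)%:E)%E.
  rewrite [RHS]integral_mkcond; apply: eq_integral => z _; rewrite patchE.
  case: ifPn => // /negP hz; rewrite derive1_step_at_outside//.
  rewrite ltNge; apply/negP; rewrite ler_norml => h; apply: hz; rewrite inE /= in_itv /=.
  by rewrite /r; lra.
rewrite (@continuous_FTC2 _ _ (step_at d x)).
- rewrite step_at1 ?step_at0//= ?subr0//; rewrite /r; lra.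
- by rewrite /r; lra.
- exact/continuous_subspaceT/step_at_derive_continuous.
- have sc : continuous (step_at d x) := smooth_continuous _ (step_at_smooth d x).
  split; first by move=> z _; exact: (smooth_derivable _ 0 _ (step_at_smooth d x)).
    by apply: cvg_at_right_filter; exact: sc.
  by apply: cvg_at_left_filter; exact: sc.
- by [].
Qed.


(** The kernel has integral 1, is at most [C / d], and vanishes outside the ball of radius [2 * d],
    of measure [4 * d]. The error is thus at most [4 * C] times the mean of [|F - F x|] on that
    ball, which tends to 0. *)
Lemma mollify_lebesgue_pt (F : R -> R) (x e : R) :
  mu.-integrable setT (EFin \o F) -> lebesgue_pt F x -> 0 < e ->
  exists2 d0, 0 < d0 & forall d, 0 < d -> d < d0 ->
    `|(\int[mu]_z (F z * derive1 (step_at d x) z))%R - F x| <= e.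
Proof.
move=> Fi Fx e0.
have [C C0 hC] := derive1_step_at_bounded.
have e'0 : 0 < e / (4 * C + 1) by rewrite divr_gt0//; lra.
have [hfin /cvgrPdist_le/(_ _ e'0) hle] := (fine_cvgP _ _).1 Fx.
have [r0 /= r00 hr0] := filterI hfin hle.
exists (r0 / 2) => [|d d0 dr0]; first by rewrite divr_gt0.
set r := 2 * d; have rr0 : 0 < r by rewrite mulr_gt0.
have [||dfin hd] := hr0 r; [|exact: rr0|].
  by rewrite /= sub0r normrN gtr0_norm// /r; lra.
have hdavg : (davg F x r <= (e / (4 * C + 1))%:E)%E.
  rewrite -(fineK dfin) lee_fin; apply: le_trans hd; rewrite sub0r normrN; exact: ler_norm.
pose T := derive1 (step_at d x).
have Tc : continuous T := step_at_derive_continuous d x.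
have Ti : mu.-integrable setT (EFin \o T) := step_at_derive_integrable d x d0.
have TC z : `|T z| <= C / d := hC d x z d0.
have FTi : mu.-integrable setT (EFin \o (fun z => F z * T z)).
  exact: integrable_mul_bounded Fi Tc TC.
have FxTi : mu.-integrable setT (EFin \o (fun z => F x * T z)).
  have -> : EFin \o (fun z => F x * T z) = (fun z => (F x)%:E * (T z)%:E)%E by [].
  exact: integrableZl.
have -> : (\int[mu]_z (F z * T z))%R - F x = (\int[mu]_z (F z * T z - F x * T z))%R.
  rewrite RintegralB// RintegralZl// Rintegral_step_at_derive// mulr1.
  by [].
have FBi : mu.-integrable setT (EFin \o (fun z => F z * T z - F x * T z)).
  have -> : EFin \o (fun z => F z * T z - F x * T z) =
    ((EFin \o (fun z => F z * T z)%R) \- (EFin \o (fun z => F x * T z)%R))%E by [].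
  exact: integrableB.
rewrite -lee_fin EFin_normr_Rintegral//.
apply: le_trans (le_abse_integral mu measurableT (measurable_int mu FBi)) _.
have mF : measurable_fun setT F by apply/measurable_EFinP; exact: measurable_int Fi.
have mball : measurable (ball x r : set (measurableTypeR R)) by exact: measurable_ball.
have mFx : measurable_fun (ball x r : set (measurableTypeR R)) (fun z => `|(F z - F x)%:E|%E).
  apply: measurable_funTS; apply/measurable_EFinP/measurableT_comp => //.
  exact: measurable_funB.
apply: (@le_trans _ _ (\int[mu]_(z in ball x r) ((C / d)%:E * `|(F z - F x)%:E|))%E).
  rewrite [leRHS]integral_mkcond; apply: ge0_le_integral => //.
  - exact: measurableT_comp (measurable_int mu FBi).
  - by have /(measurable_restrictT _ mball) := measurable_funeM (C / d)%:E mFx.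
  - move=> z _ /=; rewrite patchE; case: ifPn => [_|].
      rewrite -EFinM lee_fin -mulrBl normrM mulrC ler_wpM2r//; exact: TC.
    rewrite notin_setE /ball /= => /negP; rewrite -leNgt distrC => hz.
    rewrite /T derive1_step_at_outside// ?mulr0 ?subrr ?normr0//.
    by rewrite (lt_le_trans _ hz)// /r; lra.
rewrite ge0_integralZl//; last by rewrite lee_fin divr_ge0// ltW.
have -> : (\int[mu]_(z in ball x r) `|(F z - F x)%:E| = (r *+ 2)%:E * davg F x r)%E.
  rewrite /davg /iavg lebesgue_measure_ball ?(ltW rr0)// inver.
  rewrite mulrn_eq0 /= gt_eqF// muleA -EFinM divff ?mul1e//.
  by rewrite mulrn_eq0 /= gt_eqF.
rewrite muleA -EFinM; apply: (@le_trans _ _ ((C / d * (r *+ 2))%:E * (e / (4 * C + 1))%:E)%E).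
  by apply: lee_wpmul2l => //; rewrite lee_fin mulr_ge0 ?divr_ge0 ?mulrn_wge0// ltW.
rewrite -EFinM lee_fin /r.
have -> : C / d * ((2 * d) *+ 2) * (e / (4 * C + 1)) = (4 * C) * e / (4 * C + 1).
  by field; apply/andP; split; rewrite gt_eqF//; lra.
by rewrite ler_pdivrMr; lra.
Qed.

End Mollify.

Section RintegralLinear.
Context {R : realType}.
Local Notation mu := (@lebesgue_measure R).

Lemma integrable_linear (c : R) (f g h : R -> R) :
  mu.-integrable setT (EFin \o f) -> mu.-integrable setT (EFin \o g) ->
  mu.-integrable setT (EFin \o h) ->
  mu.-integrable setT (EFin \o (fun z => c * (f z - g z) + h z)) /\
  (\int[mu]_z (c * (f z - g z) + h z))%R =
    c * ((\int[mu]_z f z)%R - (\int[mu]_z g z)%R) + (\int[mu]_z h z)%R.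
Proof.
move=> fi gi hi.
have fgi : mu.-integrable setT (EFin \o (fun z => f z - g z)).
  have -> : EFin \o (fun z => f z - g z) = ((EFin \o f) \- (EFin \o g))%E by [].
  exact: integrableB.
have cfgi : mu.-integrable setT (EFin \o (fun z => c * (f z - g z))).
  exact: (integrableZl measurableT c fgi).
split; last by rewrite RintegralD// RintegralZl// RintegralB.
have -> : EFin \o (fun z => c * (f z - g z) + h z) =
  ((EFin \o (fun z => c * (f z - g z))%R) \+ (EFin \o h))%E by [].
exact: integrableD.
Qed.

End RintegralLinear.

(** * Variation along Lebesgue points *)

Section VariationLebesgue.
Context {R : realType} (a b : R) (F : R -> R) (K : R).
Local Notation mu := (@lebesgue_measure R).
Hypothesis ab : a < b.
Hypothesis Fi : mu.-integrable setT (EFin \o F).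
Hypothesis FK : forall phi, test_function `]a, b[%classic phi ->
  (forall x, `|phi x| <= 1) -> - (\int[mu]_x (F x * derive1 phi x))%R <= K.

Fixpoint sign_test (d p : R) (s : seq R) (z : R) : R :=
  if s is q :: s' then
    Num.sg (F q - F p) * (step_at d p z - step_at d q z) + sign_test d q s' z
  else 0.

Lemma sign_test_smooth d p s : smooth (sign_test d p s).
Proof.
elim: s p => [|q s ih] p /=; first exact: smooth_cst.
apply: smooth_add => //; apply: smooth_mul; first exact: smooth_cst.
have -> : (fun z => step_at d p z - step_at d q z) =
    (fun z => step_at d p z + (-1) * step_at d q z).
  by apply/funext => z; rewrite mulN1r.
apply: smooth_add; first exact: step_at_smooth.
by apply: smooth_mul; [exact: smooth_cst|exact: step_at_smooth].
Qed.

Lemma path_lt_last (p : R) s : path <%R p s -> p <= last p s.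
Proof.
elim: s p => //= q s ih p /andP[pq qs]; exact: le_trans (ltW pq) (ih q qs).
Qed.

(** The differences of consecutive steps are nonnegative and telescope. The bound by 1 therefore
    holds even where transitions overlap, so [d] need not be small compared with the gaps of the
    list; the same estimate locates the support. *)
Lemma sign_test_le (d p : R) s z : 0 < d -> path <%R p s ->
  `|sign_test d p s z| <= step_at d p z - step_at d (last p s) z.
Proof.
move=> d0; elim: s p => [|q s ih] p /=; first by rewrite normr0 subrr.
move=> /andP[pq qs]; apply: le_trans (ler_normD _ _) _.
have -> : step_at d p z - step_at d (last q s) z =
    (step_at d p z - step_at d q z) + (step_at d q z - step_at d (last q s) z) by ring.
apply: lerD; last exact: ih.
have h : 0 <= step_at d p z - step_at d q z by rewrite subr_ge0 step_at_le// ltW.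
rewrite normrM (ger0_norm h) -[leRHS]mul1r ler_wpM2r// normr_sg.
by case: (_ != 0).
Qed.

Lemma sign_test_bounded (d p : R) s z : 0 < d -> path <%R p s ->
  `|sign_test d p s z| <= 1.
Proof.
move=> d0 ps; apply: le_trans (sign_test_le d p s z d0 ps) _.
by have := step_at_itv d p z; have := step_at_itv d (last p s) z; lra.
Qed.

Lemma sign_test_function (d p : R) s : 0 < d -> a < p - d -> last p s + d < b ->
  path <%R p s -> test_function `]a, b[%classic (sign_test d p s).
Proof.
move=> d0 apd lb ps; split.
  by move=> n x; apply: smooth_derivable; exact: sign_test_smooth.
exists `[p - d, last p s + d]%classic; split.
- exact: segment_compact.
- move=> z /=; rewrite !in_itv /= => /andP[h1 h2].
  by rewrite (lt_le_trans apd h1) (le_lt_trans h2 lb).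
- move=> z; rewrite /= in_itv /= => hz; apply/eqP; rewrite -normr_le0.
  apply: le_trans (sign_test_le d p s z d0 ps) _.
  have pl := path_lt_last p s ps.
  have [zp|pz] := leP z (p - d).
    by rewrite step_at0// step_at0// ?subrr//; lra.
  have [lz|zl] := leP (last p s + d) z.
    by rewrite !step_at1// ?subrr//; lra.
  by exfalso; apply: hz; lra.
Qed.

Definition mollify (d x : R) : R := (\int[mu]_z (F z * derive1 (step_at d x) z))%R.

Lemma mollify_integrable (d x : R) : 0 < d ->
  mu.-integrable setT (EFin \o (fun z => F z * derive1 (step_at d x) z)).
Proof.
move=> d0; have [C C0 hC] := @derive1_step_at_bounded R.
apply: integrable_mul_bounded Fi (step_at_derive_continuous d x) _.
by move=> z; exact: (hC d x z d0).
Qed.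

Fixpoint mollified_variation (d p : R) (s : seq R) : R :=
  if s is q :: s' then
    Num.sg (F q - F p) * (mollify d q - mollify d p) + mollified_variation d q s'
  else 0.

Lemma sign_test_derive (d p : R) s : 0 < d ->
  mu.-integrable setT (EFin \o (fun z => F z * derive1 (sign_test d p s) z)) /\
  - (\int[mu]_z (F z * derive1 (sign_test d p s) z))%R = mollified_variation d p s.
Proof.
move=> d0; elim: s p => [|q s ih] p.
  have E : (fun z => F z * derive1 (sign_test d p [::]) z) = (fun=> 0).
    by apply/funext => z; rewrite derive1_cst mulr0.
  by rewrite E; split; [exact: integrable0|rewrite /Rintegral integral0 oppr0].
have [ih1 ih2] := ih q; set c := Num.sg (F q - F p).
have E : (fun z => F z * derive1 (sign_test d p (q :: s)) z) =
   (fun z => c * (F z * derive1 (step_at d p) z - F z * derive1 (step_at d q) z) +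
     F z * derive1 (sign_test d q s) z).
  apply/funext => z.
  have hp := (smooth_derive1 _ (step_at_smooth d p)).2 z.
  have hq := (smooth_derive1 _ (step_at_smooth d q)).2 z.
  have hs := (smooth_derive1 _ (sign_test_smooth d q s)).2 z.
  have h := is_deriveD (is_deriveZ c (is_deriveB hp hq)) hs.
  have -> : derive1 (sign_test d p (q :: s)) z =
     c * (derive1 (step_at d p) z - derive1 (step_at d q) z) + derive1 (sign_test d q s) z.
    by rewrite derive1E; case: h.
  by rewrite mulrDr mulrCA mulrBr.
have [i1 i2] := integrable_linear c (fun z => F z * derive1 (step_at d p) z)
  (fun z => F z * derive1 (step_at d q) z) (fun z => F z * derive1 (sign_test d q s) z)
  (mollify_integrable d p d0) (mollify_integrable d q d0) ih1.
rewrite E; split => //; rewrite [X in - X]i2 /= -ih2 opprD; congr (_ + _).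
by rewrite -mulrN opprB.
Qed.

Lemma list_variation_mollified (d p : R) s e :
  (forall x, x \in p :: s -> `|mollify d x - F x| <= e) ->
  list_variation F p s <= mollified_variation d p s + 2 * (size s)%:R * e.
Proof.
elim: s p => [|q s ih] p hd /=; first by rewrite mulr0 mul0r addr0.
have := ih q (fun x xs => hd x (mem_behead (s := p :: q :: s) xs)).
have := hd q (mem_behead (s := p :: q :: s) (mem_head _ _)).
have := hd p (mem_head _ _).
have -> : (size s).+1%:R = (size s)%:R + 1 :> R by rewrite -addn1 natrD.
move: (mollify d p) (mollify d q) (mollified_variation d q s) (list_variation F q s).
move: (F p) (F q) (size s)%:R => {ih hd} fp fq n mp mq S T.
rewrite !ler_norml => hp hq hST.
by case: (sgrP (fq - fp)); rewrite ?mul0r ?mul1r ?mulN1r; lra.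
Qed.

Lemma list_variation_lebesgue_pt (p : R) s :
  a < p -> last p s < b -> path <%R p s ->
  lebesgue_pt F p -> (forall x, x \in s -> lebesgue_pt F x) ->
  list_variation F p s <= K.
Proof.
move=> ap lb ps Lp Ls.
pose n : R := (size s)%:R.
have n0 : 0 <= n by rewrite ler0n.
suff main e : 0 < e -> list_variation F p s <= K + 2 * n * e.
  apply/ler_addgt0Pr => e e0.
  have n1 : 0 < 2 * n + 1 by lra.
  have := main (e / (2 * n + 1)) (divr_gt0 e0 n1).
  suff : 2 * n * (e / (2 * n + 1)) <= e by lra.
  by rewrite mulrA ler_pdivrMr//; lra.
move=> e0.
have [d0 d00 hd0] : exists2 d0, 0 < d0 & forall d, 0 < d -> d < d0 ->
    forall x, x \in p :: s -> `|mollify d x - F x| <= e.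
  have : forall x, x \in p :: s -> lebesgue_pt F x.
    by move=> x; rewrite inE => /predU1P[->//|]; exact: Ls.
  elim: (p :: s) => [_|x t ih hL]; first by exists 1.
  have [|d1 d10 h1] := ih; first by move=> y yt; apply: hL; rewrite inE yt orbT.
  have [d2 d20 h2] := mollify_lebesgue_pt F x e Fi (hL x (mem_head _ _)) e0.
  exists (Num.min d1 d2); first by rewrite lt_min d10.
  move=> d dpos; rewrite lt_min => /andP[dd1 dd2] y; rewrite inE => /predU1P[->|].
    exact: h2.
  exact: h1.
(* One [d] serves all the points, the list being finite; the last two bounds keep the support of the
   test function inside []a, b[]. *)
pose d := Num.min (d0 / 2) (Num.min ((p - a) / 2) ((b - last p s) / 2)).
have dpos : 0 < d by rewrite !lt_min !divr_gt0 ?subr_gt0.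
have [dd1 [dd2 dd3]] : d <= d0 / 2 /\ d <= (p - a) / 2 /\ d <= (b - last p s) / 2.
  by rewrite /d !ge_min !lexx !orbT.
have [_ E] := sign_test_derive d p s dpos.
have := FK _ (sign_test_function d p s dpos ltac:(lra) ltac:(lra) ps)
  (fun z => sign_test_bounded d p s z dpos ps).
rewrite E => hK.
have hd := hd0 d dpos ltac:(lra).
by have := list_variation_mollified d p s e hd; rewrite -/n; lra.
Qed.

End VariationLebesgue.

Section RintegralCst.
Context {R : realType}.
Local Notation mu := (@lebesgue_measure R).

Lemma Rintegral_le_cst (h : R -> R) (p q c : R)
    (N : set (measurableTypeR R)) :
  (@lebesgue_measure R).-integrable `]p, q]%classic (EFin \o h) ->
  p <= q -> measurable N -> lebesgue_measure N = 0%E ->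
  (forall x, p < x < q -> ~ N x -> h x <= c) ->
  (\int[@lebesgue_measure R]_(x in `]p, q]) h x)%R <= c * (q - p).
Proof.
move=> hi pq mN N0 hc.
have mI : measurable (`]p, q]%classic : set (measurableTypeR R)).
  exact: measurable_itv.
have muI : mu `]p, q]%classic = (q - p)%:E.
  have := @lebesgue_measure_itv R `]p, q]; rewrite /= lte_fin => hl.
  by apply: (etrans hl); case: ltgtP pq => //= -> _; rewrite subrr.
have ci : mu.-integrable `]p, q]%classic (EFin \o cst c).
  apply: measurable_bounded_integrable => //.
    by rewrite [X in (X < _)%E]muI ltry.
  by exists `|c|; split => // M cM x _ /=; exact: ltW.
pose N' : set (measurableTypeR R) := N `|` [set q].
have mN' : measurable N' by apply: measurableU => //; exact: measurable_set1.
have N'0 : mu N' = 0%E.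
  by rewrite measureU0//; exact: lebesgue_measure_set1.
have mE : measurable (`]p, q]%classic `\` N') by exact: measurableD.
have E (k : R -> R) : mu.-integrable `]p, q]%classic (EFin \o k) ->
    (\int[mu]_(x in `]p, q]) k x)%R = (\int[mu]_(x in `]p, q] `\` N') k x)%R.
  by move=> ki; congr fine; apply: negligible_integral.
have -> : c * (q - p) = (\int[mu]_(x in `]p, q]) c)%R.
  by rewrite Rintegral_cst//; congr (_ * _); rewrite [X in fine X]muI.
rewrite (E h)// (E (cst c))//; apply: le_Rintegral => //.
- by apply: integrableS hi.
- by apply: integrableS ci.
- move=> x [/=]; rewrite in_itv /= => /andP[px xq] nx; apply: hc.
    rewrite px lt_neqAle xq andbT; apply/eqP => xE; apply: nx; right; exact: xE.
  by move=> Nx; apply: nx; left.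
Qed.

End RintegralCst.

Lemma list_variation_rcons (R : realType) (f : R -> R) (p t : R) s :
  list_variation f p (rcons s t) = list_variation f p s + `|f t - f (last p s)|.
Proof.
elim: s p => [|q s ih] p /=; first by rewrite addrC.
by rewrite ih addrA.
Qed.

Lemma list_variation_norm (R : realType) (f : R -> R) (p : R) s :
  list_variation (fun x => `|f x|) p s <= list_variation f p s.
Proof.
by elim: s p => //= q s ih p; rewrite lerD// ler_dist_dist.
Qed.

Lemma variation_list_variation (R : realType) (f : R -> R) (a b : R) s :
  variation a b f s = list_variation f a s.
Proof.
elim: s a => [|q s ih] a; first by rewrite /variation big_nil.
rewrite /variation /= big_nat_recl//= -ih /variation; congr (_ + _).
Qed.

(** * The variation function along samples *)

Section VariationFunction.
Context {R : realType} (g : R -> R) (G : set R) (K : R).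
Hypothesis gK : forall p s, G p -> (forall x, x \in s -> G x) -> path <%R p s ->
  list_variation g p s <= K.

(** The value 0 keeps the set nonempty when no sample lies at or before [x], so that its supremum is
    always a genuine one. *)
Definition variations_upto (x : R) : set R := [set v | v = 0 \/
  exists p s, [/\ G p, forall y, y \in s -> G y, path <%R p s, last p s <= x &
    v = list_variation g p s]].

Definition variation_upto (x : R) : R := sup (variations_upto x).

Lemma variations_upto_neq0 x : variations_upto x !=set0.
Proof. by exists 0; left. Qed.

Lemma variations_upto_bounded x : has_ubound (variations_upto x).
Proof.
exists (Num.max 0 K) => _ [->|[p [s [Gp Gs ps _ ->]]]]; first by rewrite le_max lexx.
by rewrite le_max gK ?orbT.
Qed.

Lemma variation_upto_nd x y : x <= y -> variation_upto x <= variation_upto y.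
Proof.
move=> xy; apply: ge_sup; first exact: variations_upto_neq0.
move=> v hv; apply: ub_le_sup; first exact: variations_upto_bounded.
case: hv => [->|[p [s [Gp Gs ps lx ->]]]]; first by left.
by right; exists p, s; split => //; exact: le_trans xy.
Qed.

Lemma variation_upto_ge0 x : 0 <= variation_upto x.
Proof. by apply: ub_le_sup; [exact: variations_upto_bounded|left]. Qed.

Lemma variation_upto_le x : 0 <= K -> variation_upto x <= K.
Proof.
move=> K0; apply: ge_sup; first exact: variations_upto_neq0.
by move=> _ [->//|[p [s [Gp Gs ps _ ->]]]]; exact: gK.
Qed.

Lemma variation_upto_increment s t : G s -> G t -> s < t ->
  `|g t - g s| <= variation_upto t - variation_upto s.
Proof.
move=> Gs Gt st; rewrite lerBrDr addrC -lerBrDr; apply: ge_sup.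
  exact: variations_upto_neq0.
move=> v hv; rewrite lerBrDr; case: hv => [->|[p [l [Gp Gl pl lx ->]]]].
  rewrite add0r; apply: ub_le_sup; first exact: variations_upto_bounded.
  right; exists s, [:: t]; split => //=.
  - by move=> y; rewrite inE => /eqP ->.
  - by rewrite st.
  - by rewrite addr0.
have Gl' w : G w -> forall y, y \in rcons l w -> G y.
  by move=> Gw y; rewrite mem_rcons inE => /predU1P[->//|]; exact: Gl.
(* Lists are strictly increasing: [s] is inserted before [t] only if the list does not already end
   at [s]. *)
move: lx; rewrite le_eqVlt => /predU1P[lE|ls].
  apply: ub_le_sup; first exact: variations_upto_bounded.
  right; exists p, (rcons l t); split => //; first exact: Gl'.
  - by rewrite rcons_path pl lE.
  - by rewrite last_rcons.
  - by rewrite list_variation_rcons lE.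
apply: (@le_trans _ _ (list_variation g p (rcons (rcons l s) t))).
  by rewrite !list_variation_rcons last_rcons lerD2r lerDl.
apply: ub_le_sup; first exact: variations_upto_bounded.
right; exists p, (rcons (rcons l s) t); split => //.
- move=> y; rewrite mem_rcons inE => /predU1P[->//|]; exact: Gl'.
- by rewrite !rcons_path pl last_rcons ls.
- by rewrite last_rcons.
Qed.

Lemma variation_upto_approx x e : G !=set0 -> 0 < e -> exists p s,
  [/\ G p, path <%R p s, forall y, y \in s -> G y &
      variation_upto x - e <= list_variation g p s].
Proof.
move=> [p0 Gp0] e0; have hs : has_sup (variations_upto x).
  by split; [exact: variations_upto_neq0|exact: variations_upto_bounded].
have [v hv hlt] := sup_adherent e0 hs.
case: hv hlt => [->|[p [s [Gp Gs ps _ ->]]]] hlt.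
  by exists p0, [::]; split => //=; exact: ltW.
by exists p, s; split => //; exact: ltW.
Qed.

End VariationFunction.

(** * The largest slope of the primitive of an integrable function *)

Section MaxSlopeDensity.
Context {R : realType} (a b : R) (F : R -> R) (K : R).
Local Notation mu := (@lebesgue_measure R).
Hypothesis ab : a < b.
Hypothesis Fi : mu.-integrable setT (EFin \o F).
Hypothesis FK : forall p s, a < p -> last p s < b -> path <%R p s ->
  lebesgue_pt F p -> (forall x, x \in s -> lebesgue_pt F x) ->
  list_variation F p s <= K.

Definition primitive_norm (z : R) : R := (\int[mu]_(x in `]a, z]) `|F x|)%R.
Local Notation A := primitive_norm.
Let g x := `|F x|.
(** Lebesgue points of [F] rather than of [|F|]: testing bounds the variation of [F], and taking
    absolute values does not increase it. *)
Let G := [set x | a < x < b /\ lebesgue_pt F x].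

Lemma norm_integrable (D : set (measurableTypeR R)) : measurable D ->
  mu.-integrable D (EFin \o (fun x => `|F x|)).
Proof.
move=> mD; have -> : EFin \o (fun x => `|F x|) = (abse \o (EFin \o F)) by [].
by apply: integrable_abse; exact: integrableS Fi.
Qed.

Lemma primitive_normB p q : a <= p -> p <= q ->
  A q - A p = (\int[mu]_(x in `]p, q]) `|F x|)%R.
Proof.
move=> ap pq; rewrite /primitive_norm Rintegral_itvB ?bnd_simp//.
by apply: norm_integrable; exact: measurable_itv.
Qed.

Lemma lebesgue_pt_null : exists N : set (measurableTypeR R),
  [/\ measurable N, mu N = 0%E & forall x, ~ N x -> lebesgue_pt F x].
Proof.
have locF : locally_integrable setT F by apply: open_integrable_locally => //; exact: openT.
have [N [mN N0 hN]] := lebesgue_differentiation locF.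
exists N; split => // x Nx; apply: contrapT => hx; apply: Nx; exact: hN.
Qed.

Let avg_le p q c : a <= p -> p < q -> q <= b ->
  (forall s, G s -> p < s < q -> g s <= c) -> A q - A p <= c * (q - p).
Proof.
move=> ap pq qb h; rewrite primitive_normB// ?(ltW pq)//.
have [N [mN N0 hN]] := lebesgue_pt_null.
apply: (@Rintegral_le_cst _ _ _ _ _ N) => //; last 1 first.
- move=> x /andP[px xq] nx; apply: h; last by rewrite px.
  by split; [rewrite (le_lt_trans ap)//= (lt_le_trans xq)|exact: hN].
- by apply: norm_integrable; exact: measurable_itv.
- exact: ltW.
Qed.

Let avg_ge p q c : a <= p -> p < q -> q <= b ->
  (forall s, G s -> p < s < q -> c <= g s) -> c * (q - p) <= A q - A p.
Proof.
move=> ap pq qb h; rewrite primitive_normB// ?(ltW pq)//.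
have [N [mN N0 hN]] := lebesgue_pt_null.
have ni : mu.-integrable `]p, q]%classic (EFin \o (fun x => `|F x|)).
  by apply: norm_integrable; exact: measurable_itv.
have mI : measurable (`]p, q]%classic : set (measurableTypeR R)).
  exact: measurable_itv.
rewrite -lerN2 -mulNr.
have -> : - (\int[mu]_(x in `]p, q]) `|F x|)%R = (\int[mu]_(x in `]p, q]) (-1 * `|F x|))%R.
  by rewrite RintegralZl// mulN1r.
apply: (@Rintegral_le_cst _ _ _ _ _ N) => //.
- exact: (integrableZl mI (-1) ni).
- exact: ltW.
- move=> x /andP[px xq] nx; rewrite mulN1r lerN2; apply: h; last by rewrite px.
  by split; [rewrite (le_lt_trans ap)//= (lt_le_trans xq)|exact: hN].
Qed.

Let Gab s : G s -> a < s < b. Proof. by case. Qed.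

Let G_neq0 : G !=set0.
Proof.
have [s Gs _] := sample_dense a b A g G avg_le avg_ge a b (lexx _) ab (lexx _).
by exists s.
Qed.

Let path_last_lt (p : R) s c : p < c -> (forall x, x \in s -> x < c) -> last p s < c.
Proof.
by move=> pc sc; have := mem_last p s; rewrite inE => /predU1P[->|/sc].
Qed.

Let gK p s : G p -> (forall x, x \in s -> G x) -> path <%R p s ->
  list_variation g p s <= K.
Proof.
move=> [/andP[ap pb] Lp] Gs ps; apply: le_trans (list_variation_norm _ _ _ _) _.
apply: FK => //; last by move=> x /Gs[].
by apply: path_last_lt => // x /Gs[/andP[]].
Qed.

Let K_ge0 : 0 <= K.
Proof.
have [p Gp] := G_neq0.
by have := gK p [::] Gp; apply.
Qed.

(** Two samples of [g] differ by at most [K], so each is at most the mean of [g] over [[a, b]] plus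
    [K]. *)
Definition slope_bound : R := A b / (b - a) + K.
Local Notation B := slope_bound.

Let g_bnd s : G s -> 0 <= g s <= B.
Proof.
move=> Gs; rewrite normr_ge0 /=.
have ba : 0 < b - a by rewrite subr_gt0.
have A0 : A a = 0 by rewrite /primitive_norm set_itv_ge ?Rintegral_set0// bnd_simp ltxx.
suff : (g s - K) * (b - a) <= A b - A a.
  by rewrite A0 subr0 -ler_pdivlMr// /slope_bound; lra.
apply: avg_ge => // t Gt _.
have inc x y : G x -> G y -> x < y -> `|g y - g x| <= K.
  move=> Gx Gy xy; have := gK x [:: y] Gx; rewrite /= addr0 xy; apply => //.
  by move=> z; rewrite inE => /eqP ->.
case: (ltgtP s t) => [st|ts|->]; last by have := K_ge0; lra.
  by have := inc s t Gs Gt st; rewrite ler_norml; lra.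
by have := inc t s Gt Gs ts; rewrite ler_norml; lra.
Qed.

Let V := variation_upto g G.
Let VK := V b.
Let variation_bnd s : 0 <= V s <= K.
Proof. by rewrite (variation_upto_ge0 g G K gK)//= (variation_upto_le g G K gK). Qed.

Let gV s t : G s -> G t -> s < t -> `|g t - g s| <= V t - V s.
Proof. exact: (variation_upto_increment g G K gK). Qed.

Local Notation u := (max_slope R a b A).

Lemma max_slope_primitive_bnd x : a <= x <= b -> 0 <= u x <= B.
Proof. exact: (max_slope_bnd a b A g G B). Qed.

Lemma slope_le_max_slope x z : a <= x <= b -> a <= z <= b -> z != x ->
  slope_of R A x z <= u x.
Proof. exact: (slope_le_max a b A g G B). Qed.

Lemma max_slope_primitive_cont : cont_on R a b u.
Proof. by move=> x e; exact: (max_slope_cont a b A g V G B K). Qed.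

Lemma primitive_norm_right x z : a <= x -> x <= z -> z <= b -> A z - A x <= u x * (z - x).
Proof. exact: (max_slope_right a b A g G B). Qed.

Lemma primitive_norm_left x z : a <= z -> z <= x -> x <= b -> A x - A z <= u x * (x - z).
Proof. exact: (max_slope_left a b A g G B). Qed.

Lemma max_slope_primitive_variation s : itv_partition a b s ->
  variation a b u s <= K + 2 * B.
Proof.
move=> [ps /eqP lb]; rewrite variation_list_variation.
by apply: (max_slope_variation a b A g V G B K) => //; rewrite lb.
Qed.

Lemma max_slope_primitive_null (N : set R) : lebesgue_measure N = 0%E ->
  lam (u @` (N `&` `[a, b]%classic)) = 0%E.
Proof.
(* Lists need only approach the supremum [V b], not the given bound [K], so [V b] is the constant
   used here; truncating at [b] makes it a bound of the variation function everywhere. *)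
move=> N0; pose V' x := variation_upto g G (Num.min x b).
apply: (lam_image_max_slope a b A g V' G B VK) => //.
- move=> s; rewrite (variation_upto_ge0 g G K gK)//=; apply: (variation_upto_nd g G K gK) => //.
  by rewrite ge_min lexx orbT.
- move=> s t Gs Gt st; have /andP[_ sb] := Gab s Gs; have /andP[_ tb] := Gab t Gt.
  by rewrite /V' !min_l ?(ltW sb) ?(ltW tb)//; exact: gV.
- move=> x y xy; apply: (variation_upto_nd g G K gK) => //.
  by rewrite le_min !ge_min xy lexx orbT.
- by move=> e e0; exact: (variation_upto_approx g G K gK).
Qed.

Lemma max_slope_primitive_density : exists h : R -> R,
  [/\ mu.-integrable setT (EFin \o h),
    forall x, a <= x <= b -> ((u x - u a)%:E =
       \int[mu]_(t in `]a, x]) (h t)%:E)%E &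
    (\int[mu]_(t in `]a, b]) `|(h t)%:E| <= (K + 2 * B)%:E)%E].
Proof.
have bv : bounded_variation a b u.
  by exists (K + 2 * B) => _ [s abs <-]; exact: max_slope_primitive_variation.
have [h [hi hE hle]] := density_of_luzin R a b u ab max_slope_primitive_cont bv
  max_slope_primitive_null.
exists h; split => //; apply: le_trans hle _.
apply: ge_ereal_sup => _ [_ [s abs <-] <-]; rewrite lee_fin.
exact: max_slope_primitive_variation.
Qed.

End MaxSlopeDensity.

(** * The maximal function on a bounded interval *)

Lemma bounded_interval_ends (R : realType) (I : set R) :
  nondegenerate_interval I -> bounded_set I ->
  [/\ inf I < sup I, I° = `]inf I, sup I[%classic,
      `]inf I, sup I[%classic `<=` I, I `<=` `[inf I, sup I]%classic & measurable I].
Proof.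
move=> [itvI [x [y [Ix Iy xy]]]] [M [_ /(_ (M + 1))]].
rewrite ltrDl ltr01 => /(_ isT) hM.
have lbI : has_lbound I.
  by exists (- (M + 1)) => z /hM /=; rewrite ler_norml => /andP[].
have ubI : has_ubound I.
  by exists (M + 1) => z /hM /=; rewrite ler_norml => /andP[].
have intI := interval_bounded_interior itvI lbI ubI.
have E : I° = `]inf I, sup I[%classic.
  by rewrite intI; apply/seteqP; split => z /=; rewrite in_itv.
split => //.
- by apply: le_lt_trans (lt_le_trans xy _); [exact: ge_inf|exact: ub_le_sup].
- by rewrite -E; exact: interior_subset.
- by move=> z Iz /=; rewrite in_itv /= ge_inf//= ub_le_sup.
- exact: is_interval_measurable.
Qed.

Lemma integral_between_itv (R : realType) (J : set (measurableTypeR R))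
    (p q : R) (h : R -> \bar R) :
  measurable J -> `]p, q[%classic `<=` J -> J `<=` `[p, q]%classic ->
  (forall x, (0 <= h x)%E) -> measurable_fun J h ->
  (\int[@lebesgue_measure R]_(x in J) h x =
   \int[@lebesgue_measure R]_(x in `]p, q[) h x)%E.
Proof.
move=> mJ Jl Jr h0 mh.
pose N : set (measurableTypeR R) := [set p] `|` [set q].
have mN : measurable N by apply: measurableU; exact: measurable_set1.
have N0 : lebesgue_measure N = 0%E.
  by rewrite measureU0//; exact: lebesgue_measure_set1.
rewrite (ge0_negligible_integral mN)//; congr integral.
apply/seteqP; split => [x [Jx nx]|x xpq].
  have /= := Jr x Jx; rewrite !in_itv /= !lt_neqAle => /andP[-> ->].
  rewrite !andbT; apply/andP; split; apply/eqP => xE; apply: nx.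
    by left; rewrite /= xE.
  by right.
split; first exact: Jl.
move: xpq; rewrite /= in_itv /= => /andP[px xq] [xE|xE]; move: px xq.
  by rewrite xE ltxx.
by rewrite xE ltxx.
Qed.

Lemma lebesgue_measure_between_itv (R : realType) (J : set (measurableTypeR R))
    (p q : R) : measurable J -> p <= q ->
  `]p, q[%classic `<=` J -> J `<=` `[p, q]%classic ->
  lebesgue_measure J = (q - p)%:E.
Proof.
move=> mJ pq Jl Jr.
have lo : lebesgue_measure `]p, q[%classic = (q - p)%:E.
  apply: (etrans (lebesgue_measure_itv `]p, q[)); rewrite /= lte_fin.
  by case: ltgtP pq => // -> _; rewrite subrr.
apply/eqP; rewrite eq_le; apply/andP; split.
  by rewrite -(lam_itv _ _ pq); exact: (le_outer_measure lam).
by rewrite -lo; exact: (le_outer_measure lam).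
Qed.

Section MaximalFunction.
Context {R : realType} (I : set R) (a b : R) (f : R -> R) (K : R).
Local Notation mu := (@lebesgue_measure R).
Hypothesis ab : a < b.
Hypothesis Iint : I° = `]a, b[%classic.
Hypothesis Il : `]a, b[%classic `<=` I.
Hypothesis Ir : I `<=` `[a, b]%classic.
Hypothesis mI : measurable (I : set (measurableTypeR R)).
Hypothesis fi : mu.-integrable I (EFin \o f).
Hypothesis fK : derive_variation I f = K%:E.

Let D : set (measurableTypeR R) := `]a, b[%classic.
Let F := f \_ D.

Let mD : measurable D. Proof. exact: measurable_itv. Qed.

Let fD : mu.-integrable D (EFin \o f). Proof. exact: integrableS fi. Qed.

Let Fi : mu.-integrable setT (EFin \o F).
Proof.
have -> : EFin \o F = (EFin \o f) \_ D by rewrite /F restrict_EFin.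
by apply/(integrable_mkcond _ _).1.
Qed.

Let FK p s : a < p -> last p s < b -> path <%R p s ->
  lebesgue_pt F p -> (forall x, x \in s -> lebesgue_pt F x) ->
  list_variation F p s <= K.
Proof.
apply: list_variation_lebesgue_pt => // phi tphi phi1.
rewrite -lee_fin -fK; apply: ereal_sup_ubound; exists phi.
  by rewrite Iint; split.
rewrite /distr_derive Iint; congr (- _)%:E.
rewrite Rintegral_mkcond; apply: eq_Rintegral => x _.
rewrite /F !patchE; case: ifPn => // _.
by rewrite mul0r.
Qed.

Local Notation A := (primitive_norm a F).
Local Notation u := (max_slope R a b A).

Lemma iavg_slope (J : set (measurableTypeR R)) (p q : R) : measurable J ->
  a <= p -> p < q -> q <= b -> `]p, q[%classic `<=` J -> J `<=` `[p, q]%classic ->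
  J `<=` I -> iavg f J = ((A q - A p) / (q - p))%:E.
Proof.
move=> mJ ap pq qb Jl Jr JI.
rewrite /iavg (lebesgue_measure_between_itv R J p q)// ?(ltW pq)//.
have mf : measurable_fun J (fun x => `|(f x)%:E|%E).
  apply: (measurable_funS _ JI) => //.
  by apply: measurableT_comp => //; exact: measurable_int fi.
rewrite (integral_between_itv R J p q)//.
have mF : measurable_fun setT F by apply/measurable_EFinP; exact: measurable_int Fi.
have -> : (\int[mu]_(y in `]p, q[) `|(f y)%:E| = (A q - A p)%:E)%E.
  rewrite primitive_normB//; last exact: ltW.
  rewrite /Rintegral fineK; last first.
    apply: integrable_fin_num; first exact: measurable_itv.
    by apply: norm_integrable => //; exact: measurable_itv.
  rewrite (integral_between_itv R `]p, q] p q).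
  - apply: eq_integral => x; rewrite inE /= in_itv /= => /andP[px xq].
    rewrite /F patchE mem_set// /D /= in_itv /=.
    by rewrite (le_lt_trans ap px) (lt_le_trans xq qb).
  - exact: measurable_itv.
  - by apply: subset_itvl; rewrite bnd_simp.
  - by apply: subset_itvr; rewrite bnd_simp.
  - by move=> x; rewrite lee_fin.
  - by apply: measurable_funTS; apply/measurable_EFinP; exact: measurableT_comp.
rewrite inver subr_eq0 gt_eqF// -EFinM; congr EFin; exact: mulrC.
Qed.

Lemma maximal_functionE x : I x -> maximal_function I f x = (u x)%:E.
Proof.
move=> Ix; have xab : a <= x <= b by have /= := Ir x Ix; rewrite in_itv.
have /andP[ax xb] := xab.
apply/eqP; rewrite eq_le; apply/andP; split.
  apply: ge_ereal_sup => _ [J [nJ bJ Jx JI] <-].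
  have [pq _ Jl Jr mJ] := bounded_interval_ends R J nJ bJ.
  have ap : a <= inf J.
    apply: lb_le_inf; first by exists x.
    by move=> y /JI /Ir /=; rewrite in_itv /= => /andP[].
  have qb : sup J <= b.
    apply: ge_sup; first by exists x.
    by move=> y /JI /Ir /=; rewrite in_itv /= => /andP[].
  rewrite (iavg_slope J (inf J) (sup J))// lee_fin.
  have /= := Jr x Jx; rewrite in_itv /= => /andP[px xq].
  rewrite ler_pdivrMr ?subr_gt0//.
  have h1 := primitive_norm_right a b F K ab Fi FK x (sup J) ax xq qb.
  have h2 := primitive_norm_left a b F K ab Fi FK x (inf J) ap px xb.
  by lra.
have hub : has_ubound [set slope_of R A x z | z in [set z | a <= z <= b /\ z != x]].
  by exists (u x) => _ [z [zab zx] <-]; exact: (slope_le_max_slope a b F K ab Fi FK).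
have hne : [set slope_of R A x z | z in [set z | a <= z <= b /\ z != x]] !=set0.
  have [xe|xe] := eqVneq x a.
    by exists (slope_of R A x b), b => //; split; [rewrite (ltW ab) lexx|rewrite xe gt_eqF].
  by exists (slope_of R A x a), a => //; split; [rewrite (ltW ab) lexx|rewrite eq_sym].
rewrite /max_slope -ereal_sup_EFin//.
apply: ge_ereal_sup => _ [_ [z [/andP[az zb] zx] <-] <-].
apply: ereal_sup_ubound.
have bnd (p q : R) (J : set R) : J `<=` `[p, q]%classic -> bounded_set J.
  move=> Jpq; exists (`|p| + `|q|); split => // M hM y /Jpq /=.
  rewrite in_itv /= ler_norml => /andP[py yq].
  have := ler_norm q; have := ler_norm (- p); rewrite normrN => h1 h2.
  by have := normr_ge0 q; have := normr_ge0 p; lra.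
case: (ltgtP x z) zx => // [xz|zx] _.
(* The far end is left out of the interval because [z] may be [a] or [b], which need not belong to
   [I]. *)
- exists `[x, z[%classic.
    split.
    + split; first exact: interval_is_interval.
      exists x, ((x + z) / 2); rewrite /= !in_itv /=; split; lra.
    + by apply: (bnd x z); apply: subset_itvl; rewrite bnd_simp.
    + by rewrite /= in_itv /= lexx.
    + move=> y; rewrite /= in_itv /= le_eqVlt => /andP[/predU1P[<-//|xy] yz].
      by apply: Il; rewrite /= in_itv /= (le_lt_trans ax xy) (lt_le_trans yz zb).
  rewrite (iavg_slope _ x z)//.
  + by apply: subset_itvr; rewrite bnd_simp.
  + by apply: subset_itvl; rewrite bnd_simp.
  + move=> y; rewrite /= in_itv /= le_eqVlt => /andP[/predU1P[<-//|xy] yz].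
    by apply: Il; rewrite /= in_itv /= (le_lt_trans ax xy) (lt_le_trans yz zb).
- exists `]z, x]%classic.
    split.
    + split; first exact: interval_is_interval.
      exists ((x + z) / 2), x; rewrite /= !in_itv /=; split; lra.
    + by apply: (bnd z x); apply: subset_itvr; rewrite bnd_simp.
    + by rewrite /= in_itv /= lexx zx.
    + move=> y; rewrite /= in_itv /= le_eqVlt => /andP[zy /predU1P[->//|yx]].
      by apply: Il; rewrite /= in_itv /= (le_lt_trans az zy) (lt_le_trans yx xb).
  rewrite (iavg_slope _ z x)//.
  + by congr EFin; rewrite /slope_of -opprB -(opprB z) invrN mulrNN.
  + by apply: subset_itvl; rewrite bnd_simp.
  + by apply: subset_itvr; rewrite bnd_simp.
  + move=> y; rewrite /= in_itv /= le_eqVlt => /andP[zy /predU1P[->//|yx]].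
    by apply: Il; rewrite /= in_itv /= (le_lt_trans az zy) (lt_le_trans yx xb).
Qed.

Lemma primitive_norm_L1norm : L1norm I f = (A b)%:E.
Proof.
rewrite /L1norm (integral_between_itv R I a b)//; last first.
  by apply: measurableT_comp => //; exact: measurable_int fi.
have mF : measurable_fun setT F by apply/measurable_EFinP; exact: measurable_int Fi.
rewrite /primitive_norm /Rintegral fineK; last first.
  apply: integrable_fin_num; first exact: measurable_itv.
  by apply: norm_integrable => //; exact: measurable_itv.
rewrite [RHS](integral_between_itv R `]a, b] a b).
- by apply: eq_integral => x xD; rewrite /F patchE xD.
- exact: measurable_itv.
- by apply: subset_itvl; rewrite bnd_simp.
- by apply: subset_itvr; rewrite bnd_simp.
- by move=> x; rewrite lee_fin.
- by apply: measurable_funTS; apply/measurable_EFinP; exact: measurableT_comp.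
Qed.

Local Notation B := (slope_bound a b F K).
Local Notation Mf := (fine \o maximal_function I f).

Let MfE x : I x -> Mf x = u x.
Proof. by move=> Ix /=; rewrite maximal_functionE. Qed.

Let u_bnd x : a <= x <= b -> 0 <= u x <= B.
Proof. exact: (max_slope_primitive_bnd a b F K ab Fi FK). Qed.

Let u_cont : cont_on R a b u.
Proof. exact: (max_slope_primitive_cont a b F K ab Fi FK). Qed.

Let mMf : measurable_fun (I : set (measurableTypeR R)) Mf.
Proof.
apply: (eq_measurable_fun (u \o clamp R a b)).
  move=> x; rewrite inE => Ix; rewrite MfE//= clamp_id//.
  by have /= := Ir x Ix; rewrite in_itv.
apply: measurable_funTS; apply: continuous_measurable_fun.
exact: (continuous_clamp a b (ltW ab) u u_cont).
Qed.

Let muI : mu I = (b - a)%:E.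
Proof. exact: (lebesgue_measure_between_itv R I a b mI (ltW ab) Il Ir). Qed.

Let Mf_bnd x : I x -> `|Mf x| <= B.
Proof.
move=> Ix; have xab : a <= x <= b by have /= := Ir x Ix; rewrite in_itv.
by rewrite MfE//; have /andP[u0 uB] := u_bnd x xab; rewrite ger0_norm.
Qed.

Lemma maximal_function_L1 : L1 I Mf.
Proof.
apply: measurable_bounded_integrable => //; first by rewrite [X in (X < _)%E]muI ltry.
by exists B; split; [exact: num_real|move=> M BM x Ix; apply: le_trans (Mf_bnd x Ix) (ltW BM)].
Qed.

Lemma maximal_function_L1norm : (L1norm I Mf <= (B * (b - a))%:E)%E.
Proof.
have B0 : 0 <= B.
  by have := u_bnd a; rewrite lexx (ltW ab) => /(_ isT)/andP[]; exact: le_trans.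
rewrite EFinM -muI; apply: integral_le_bound => //.
- exact/measurable_EFinP.
- by apply: aeW => x Ix; rewrite lee_fin; exact: Mf_bnd.
Qed.

Lemma maximal_function_weak_derive : exists h : R -> R,
  [/\ is_weak_derive I Mf h, L1 I h & (L1norm I h <= (K + 2 * B)%:E)%E].
Proof.
have [h [hi hE hle]] := max_slope_primitive_density a b F K ab Fi FK.
exists h; split.
- split.
    rewrite Iint; apply: open_integrable_locally; first exact: interval_open.
    by apply: integrableS hi.
  rewrite Iint => phi tphi.
  have wd := weak_derive_density a b phi ab tphi u h hi hE.
  have pc := test_function_continuous a b phi tphi.
  have p'c := test_function_derive_continuous a b phi tphi.
  have p'i := vanishing_integrable a b (derive1 phi) D p'c
    (test_function_derive_outside a b phi tphi) mD.
  rewrite /distr_derive Iint.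
  have [C C0 hC] := vanishing_bounded a b ab (derive1 phi) p'c
    (test_function_derive_outside a b phi tphi).
  have uc := continuous_clamp a b (ltW ab) u u_cont.
  have ui : mu.-integrable D (EFin \o (fun x => u x * derive1 phi x)).
    apply: (@eq_integrable _ _ _ mu D mD
      (EFin \o (fun x => (u \o clamp R a b) x * derive1 phi x))).
      move=> x; rewrite inE /D /= in_itv /= => /andP[ax xb].
      by rewrite clamp_id// !ltW.
    apply: (vanishing_integrable a b) => //.
      by move=> x; apply: cvgM; [exact: uc|exact: p'c].
    by move=> x hx; rewrite (test_function_derive_outside a b phi tphi)// mulr0.
  (* This allows [u] to be replaced by [u - u a], the primitive of [h] that integration by parts
     treats. *)
  have int0 : (\int[mu]_(x in D) derive1 phi x)%R = 0.
    have := test_function_FTC a b phi tphi a ab.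
    rewrite (test_function_outside a b phi tphi) ?ltxx// oppr0 => h0.
    transitivity (fine (\int[mu]_(x in `[a, b]) (derive1 phi x)%:E)%E); last by rewrite h0.
    congr fine.
    rewrite [LHS]integral_mkcond [RHS]integral_mkcond; apply: eq_integral => x _.
    rewrite !patchE; case: ifPn => xD; case: ifPn => xI //.
      move: xD xI; rewrite inE notin_setE /D /= !in_itv /= => /andP[/ltW ax /ltW xb].
      by rewrite ax xb.
    rewrite (test_function_derive_outside a b phi tphi)// => xab.
    by move: xD; rewrite notin_setE /D /= in_itv.
  have -> : (\int[mu]_(x in D) (Mf x * derive1 phi x))%R =
      (\int[mu]_(x in D) (u x * derive1 phi x))%R.
    by apply: eq_Rintegral => x; rewrite inE => /Il Ix; rewrite MfE.
  have -> : (\int[mu]_(x in D) (u x * derive1 phi x))%R =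
      (\int[mu]_(x in D) ((u x - u a) * derive1 phi x))%R.
    transitivity (\int[mu]_(x in D) (u x * derive1 phi x - u a * derive1 phi x))%R.
      rewrite RintegralB//; last exact: (integrableZl mD (u a) p'i).
      by rewrite RintegralZl// int0 mulr0 subr0.
    by apply: eq_Rintegral => x _; rewrite mulrBl.
  by rewrite {1}/Rintegral wd fineN opprK.
- by apply: integrableS hi.
- apply: le_trans hle.
  have mh : measurable_fun setT (fun x => `|(h x)%:E|%E).
    by apply: measurableT_comp => //; exact: measurable_int hi.
  rewrite /L1norm (integral_between_itv R I a b)//; last exact: measurable_funTS.
  rewrite (integral_between_itv R `]a, b] a b)//.
  - by apply: subset_itvl; rewrite bnd_simp.
  - by apply: subset_itvr; rewrite bnd_simp.
  - exact: measurable_funTS.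
Qed.

End MaximalFunction.

Lemma derive_variation_ge0 (R : realType) (I : set R) (f : R -> R) :
  (0 <= derive_variation I f)%E.
Proof.
apply: ereal_sup_ubound; exists (cst 0).
  split; last by move=> x /=; rewrite normr0.
  split; last by exists set0; split => //; exact: compact0.
  by move=> n x; apply: smooth_derivable; exact: smooth_cst.
rewrite /distr_derive (_ : (fun x => _) = cst 0); last first.
  by apply/funext => x; rewrite derive1_cst mulr0.
by rewrite /Rintegral integral0 oppr0.
Qed.

Theorem corollary2p9 (R : realType) (I : set R)
    (hI : nondegenerate_interval I) (bI : bounded_set I) :
  exists c : R, forall f : R -> R, BV I f ->
    [/\ forall x, I x -> maximal_function I f x \is a fin_num,
        W11 I (fine \o maximal_function I f) &
        (W11norm I (fine \o maximal_function I f) <= c%:E * BVnorm I f)%E].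
Proof.
have [ab Iint Il Ir mI] := bounded_interval_ends R I hI bI.
set a := inf I in ab Iint Il Ir; set b := sup I in ab Iint Il Ir.
(* With l the length of [I], N the norm of [f] in L1 and [B = N / l + K], the bounds [B * l] for the
   function and [K + 2 * B] for its derivative add up to [(1 + 2 / l) * N + (3 + l) * K]; this
   constant dominates both coefficients. *)
exists (4 + (b - a) + 2 / (b - a)) => f [fi fvar].
have [K fK] : exists K, derive_variation I f = K%:E.
  exists (fine (derive_variation I f)); rewrite fineK// ge0_fin_numE//.
  exact: derive_variation_ge0.
have K0 : 0 <= K by rewrite -lee_fin -fK derive_variation_ge0.
have ME := maximal_functionE I a b f K ab Iint Il Ir mI fi fK.
have [h [hw hi hle]] := maximal_function_weak_derive I a b f K ab Iint Il Ir mI fi fK.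
have ML1 := maximal_function_L1 I a b f K ab Iint Il Ir mI fi fK.
split.
- by move=> x Ix; rewrite ME.
- by split => //; exists h.
- have hB := maximal_function_L1norm I a b f K ab Iint Il Ir mI fi fK.
  rewrite /BVnorm fK (primitive_norm_L1norm I a b f Il Ir mI fi).
  have inf_le : (ereal_inf [set L1norm I g | g in
      is_weak_derive I (fine \o maximal_function I f)] <= L1norm I h)%E.
    by apply: ereal_inf_lbound; exists h.
  apply: le_trans (leeD hB (le_trans inf_le hle)) _.
  rewrite -!EFinD -EFinM lee_fin /slope_bound.
  set N := primitive_norm _ _ _; have N0 : 0 <= N by exact: Rintegral_ge0.
  have l0 : 0 < b - a by rewrite subr_gt0.
  move: (b - a) l0 N N0 => l l0 N N0.
  have -> : (N / l + K) * l + (K + 2 * (N / l + K)) =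
      N + K * l + 3 * K + N * (2 / l) by field; rewrite gt_eqF.
  have k0 : 0 <= 2 / l by rewrite divr_ge0// ltW.
  move: (2 / l) k0 => k k0.
  by have := mulr_ge0 (ltW l0) N0; have := mulr_ge0 k0 K0; lra.
Qed.
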